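(* Let $\rho>0$, let $q$ be a potential on $\mathbb R$ with $\operatorname{supp}q\subset(-\rho,\rho)$ and $q(x)=\overline{q(-x)}$, and let $H$ be the closed densely defined operator in $L_2(\mathbb R)$ determined by the differential expression $-\frac{d^2}{dx^2}+q(x)$; $H$ is then a $\mathcal{PT}$-symmetric $\rho$-perturbed operator, where $(\mathcal Pf)(x)=f(-x)$ and $(\mathcal Tf)(x)=\overline{f(x)}$. For $k\in\Lambda_+'=\{k\in\mathbb C_+:\operatorname{Re}k\ne0,\ k^2\in\rho(H)\}$ let $R_k^l,R_k^r,T_k^l,T_k^r$ be the reflection and transmission coefficients of $H$ and let $$\Delta_k=\det\begin{pmatrix}R_k^r+\frac{\overline\theta}{\theta}e^{-2i\rho\operatorname{Re}k}& T_k^r\\ T_k^l& R_k^l+\frac{\overline\theta}{\theta}e^{-2i\rho\operatorname{Re}k}\end{pmatrix},\qquad \theta=1+ik.$$ Then for every $k\in\Lambda_+'$ with $\Delta_k\neq0$ the $S$-matrix $\mathsf S(k)$ of $H$ exists and $$\mathsf S(k)=-e^{2i\rho\operatorname{Re}k}\,\frac{k}{\operatorname{Re}k}\begin{pmatrix}R_k^r+ i\,e^{-2i\rho\operatorname{Re}k}\frac{\operatorname{Im}k}{k}& T_k^l\\ T_k^r& R_k^l+ i\,e^{-2i\rho\operatorname{Re}k}\frac{\operatorname{Im}k}{k}\end{pmatrix}.$$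
   Context: $\mathbb C_+=\{k:\operatorname{Im}k>0\}$; $\rho(H)$ denotes the resolvent set of $H$ (not to be confused with the number $\rho$). Let $\mathfrak H_\rho=L_2(\mathbb R\setminus(-\rho,\rho))$, $P_\rho$ the orthogonal projection of $L_2(\mathbb R)$ onto $\mathfrak H_\rho$ (restriction to $|x|\ge\rho$), and in $\mathfrak H_\rho$ let $B_\rho^2=-\frac{d^2}{dx^2}$ with domain the functions in $W_2^2(-\infty,-\rho)\oplus W_2^2(\rho,\infty)$ with $f(\pm\rho)=f'(\pm\rho)=0$; its adjoint is $(B_\rho^* )^2=-\frac{d^2}{dx^2}$ with domain $W_2^2(-\infty,-\rho)\oplus W_2^2(\rho,\infty)$. A closed densely defined operator $H$ in $L_2(\mathbb R)$ is $\rho$-perturbed if both $H$ and $H^*$ are extensions of $B_\rho^2$; it is $\mathcal{PT}$-symmetric if $\mathcal{PT}$ maps $\mathcal D(H)$ into itself and $\mathcal{PT}Hf=H\mathcal{PT}f$ for $f\in\mathcal D(H)$. It is assumed that the differential expression $-\frac{d^2}{dx^2}+q$ determines a closed densely defined operator $H$; that $H$ is $\rho$-perturbed and $\mathcal{PT}$-symmetric is part of the setting. Image set: for $k\in\mathbb C_+$ with $k^2\in\rho(H)$, $H_k=(B_\rho^* )^2\upharpoonright_{\mathcal D(H_k)}$ with $\mathcal D(H_k)=P_\rho(H-k^2I)^{-1}\mathfrak H_\rho$. $S$-matrix: with $\mathcal H=\ker((B_\rho^* )^2+I)$, the boundary maps are $\Gamma_0f=\frac12(f(-\rho)\psi_-+f(\rho)\psi_+)$,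 $\Gamma_1f=[f(-\rho)-f'(-\rho)]\psi_-+[f(\rho)+f'(\rho)]\psi_+$, where $\psi_-(x)=2e^{\rho+x}$ for $x\le-\rho$ and $0$ for $x\ge\rho$, $\psi_+(x)=2e^{\rho-x}$ for $x\ge\rho$ and $0$ for $x\le-\rho$. The identification $Y:\mathcal H\to\mathbb C^2$ is given by $Y\psi_\pm=\sqrt2e_\pm$, $e_+=(1,0)^T$, $e_-=(0,1)^T$. The $S$-matrix $\mathsf S(k)$ exists at $k$ if there is a $2\times2$ matrix $\mathsf T_k$ with $\mathcal D(H_k)=\{f\in\mathcal D((B_\rho^* )^2):\mathsf T_kY\Gamma_1f=Y\Gamma_0f\}$, i.e. $\mathcal D(H_k)$ consists exactly of those $f\in W_2^2(-\infty,-\rho)\oplus W_2^2(\rho,\infty)$ with $$\mathsf T_k\begin{pmatrix}f(\rho)+f'(\rho)\\ f(-\rho)-f'(-\rho)\end{pmatrix}=\frac12\begin{pmatrix}f(\rho)\\ f(-\rho)\end{pmatrix},$$ and $I-2(1+ik)\mathsf T_k$ is invertible; then $\mathsf S(k):=[I-2(1-ik)\mathsf T_k][I-2(1+ik)\mathsf T_k]^{-1}$. Reflection/transmission coefficients for $k\in\Lambda_+'$: let $\beta=\overline k^2-k^2$, $h_1(x)=\beta e^{-i\overline kx}$ for $x\ge\rho$ and $0$ for $x<\rho$; $h_2(x)=\beta e^{i\overline kx}$ for $x\le-\rho$ and $0$ for $x>-\rho$. Then $f_j=P_\rho(H-k^2I)^{-1}h_j$, $j=1,2$, have the form $$f_1=\begin{cases}e^{-i\overline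 kx}+R_k^re^{ikx},&x\ge\rho\\ T_k^re^{-ikx},&x\le-\rho\end{cases},\qquad f_2=\begin{cases}T_k^le^{ikx},&x\ge\rho\\ e^{i\overline kx}+R_k^le^{-ikx},&x\le-\rho\end{cases},$$ which defines the complex numbers $R_k^l,R_k^r,T_k^l,T_k^r$. *)

(* Defs.v *)
From HB Require Import structures.
From mathcomp Require Import all_boot all_order all_algebra.
From mathcomp Require Import all_classical all_reals all_analysis.
From mathcomp Require Import complex.

Set Implicit Arguments.
Unset Strict Implicit.
Unset Printing Implicit Defensive.

Import Order.TTheory GRing.Theory Num.Theory.
Import numFieldNormedType.Exports.

Local Open Scope classical_set_scope.
Local Open Scope ring_scope.
Local Open Scope complex_scope.

Section Defs.
Context {R : realType}.

Local Notation C := R[i].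
(* Both ring_scope and complex_scope interpret 'i and ^*. *)
Local Notation Re := (@complex.Re R).
Local Notation Im := (@complex.Im R).
Local Notation "''i'" := ('i%C : C) : ring_scope.
Local Notation "z ^*" := (conjc z) : ring_scope.
Local Notation mu := (@lebesgue_measure R).

Definition cexp (z : C) : C :=
  (expR (Re z))%:C * (cos (Im z) +i* sin (Im z)).

Definition mat2 (a b c d : C) : 'M[C]_2 :=
  \matrix_(i < 2, j < 2)
    if i == 0 then (if j == 0 then a else b) else (if j == 0 then c else d).

Definition col2 (a b : C) : 'cV[C]_2 := \col_(i < 2) if i == 0 then a else b.

Definition cintegrable (D : set R) (f : R -> C) : Prop :=
  mu.-integrable D (fun x => (Re (f x))%:E) /\
  mu.-integrable D (fun x => (Im (f x))%:E).

Definition cintegral (D : set R) (f : R -> C) : C :=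
  (\int[mu]_(x in D) Re (f x)) +i* (\int[mu]_(x in D) Im (f x)).

(* Elements of L_2(R) are handled through representatives: square-integrable
   functions, compared with equality almost everywhere. *)
Definition L2 (f : R -> C) : Prop :=
  (fun x => Re (f x)) \in Lfun mu 2%:E /\ (fun x => Im (f x)) \in Lfun mu 2%:E.

Definition dot2 (f g : R -> C) : C := cintegral setT (fun x => f x * (g x)^*).

Definition norm2 (f : R -> C) : R := Num.sqrt (Re (dot2 f f)).

Definition cvg2 (f_ : nat -> R -> C) (f : R -> C) : Prop :=
  norm2 (fun x => f_ n x - f x) @[n --> \oo] --> (0 : R).

(* A linear operator in L_2(R), given by its graph: [H f g] reads
   "f is in the domain of H and H f = g". *)
Record L2operator := L2Operator {
  op_graph :> (R -> C) -> (R -> C) -> Prop ;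
  op_L2 : forall f g, op_graph f g -> L2 f /\ L2 g ;
  op_ae : forall f f' g g', L2 f' -> L2 g' ->
    f = f' %[ae mu] -> g = g' %[ae mu] -> op_graph f g -> op_graph f' g' ;
  op_zero : op_graph (fun=> 0) (fun=> 0) ;
  op_linear : forall (a : C) f f' g g', op_graph f g -> op_graph f' g' ->
    op_graph (fun x => a * f x + f' x) (fun x => a * g x + g' x) ;
  op_functional : forall f g g',
    op_graph f g -> op_graph f g' -> g = g' %[ae mu] }.

Implicit Type H : L2operator.

Definition densely_defined H : Prop :=
  forall f, L2 f -> forall e : R, 0 < e ->
    exists g h, H g h /\ norm2 (fun x => f x - g x) < e.

Definition closed_operator H : Prop :=
  forall (f_ g_ : nat -> R -> C) f g, (forall n, H (f_ n) (g_ n)) ->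
    L2 f -> L2 g -> cvg2 f_ f -> cvg2 g_ g -> H f g.

Definition adjoint H (u v : R -> C) : Prop :=
  [/\ L2 u, L2 v & forall f g, H f g -> dot2 g u = dot2 f v].

(* The bound entails the injectivity of H - z. *)
Definition resolvent_set H : set C := [set z |
  (forall h, L2 h ->
     exists f g, H f g /\ (fun x => g x - z * f x) = h %[ae mu]) /\
  (exists M : R, forall f g, H f g ->
     norm2 f <= M * norm2 (fun x => g x - z * f x))].

(* [resolvent H z h f] reads (H - z)^-1 h = f. *)
Definition resolvent H (z : C) (h f : R -> C) : Prop :=
  H f (fun x => h x + z * f x).

(* On every segment contained in D, u is absolutely continuous and has
   derivative v almost everywhere. *)
Definition ac_deriv (D : set R) (u v : R -> C) : Prop :=
  forall x y, x <= y -> `[x, y]%classic `<=` D ->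
    cintegrable `[x, y]%classic v /\ u y - u x = cintegral `[x, y]%classic v.

(* H acts as the differential expression - d^2/dx^2 + q. *)
Definition acts_as_schrodinger (q : R -> C) H : Prop :=
  forall f g, H f g -> exists u u1 u2 : R -> C,
    [/\ ac_deriv setT u u1, ac_deriv setT u1 u2, f = u %[ae mu] &
        g = (fun x => - u2 x + q x * u x) %[ae mu]].

Definition PT (f : R -> C) : R -> C := fun x => (f (- x))^*.

Definition PT_symmetric H : Prop := forall f g, H f g -> H (PT f) (PT g).

Definition ext (rho : R) : set R := [set x | rho <= `|x|].

(* The space L_2(R \ (-rho, rho)) is identified with the subspace of L_2(R) of
   the functions vanishing on (-rho, rho), onto which [proj rho] projects. *)
Definition proj (rho : R) (f : R -> C) : R -> C :=
  fun x => if rho <= `|x| then f x else 0.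

Definition L2ext (rho : R) (f : R -> C) : Prop :=
  L2 f /\ f = proj rho f %[ae mu].

(* u is the continuous representative of an element of
   W_2^2(-oo, -rho) (+) W_2^2(rho, +oo), u1 = u' and u2 = u''; a segment
   contained in [ext rho] lies in one of the two half-lines, end point
   included, so that u (+- rho) and u1 (+- rho) are the boundary values. *)
Definition W22 (rho : R) (u u1 u2 : R -> C) : Prop :=
  [/\ L2 (proj rho u), L2 (proj rho u1), L2 (proj rho u2),
      ac_deriv (ext rho) u u1 & ac_deriv (ext rho) u1 u2].

Definition Brho2 (rho : R) (f g : R -> C) : Prop :=
  [/\ L2 f, L2 g & exists u u1 u2 : R -> C,
    [/\ W22 rho u u1 u2,
        [/\ u rho = 0, u (- rho) = 0, u1 rho = 0 & u1 (- rho) = 0],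
        f = proj rho u %[ae mu] &
        g = proj rho (fun x => - u2 x) %[ae mu]]].

Definition rho_perturbed (rho : R) H : Prop :=
  [/\ closed_operator H, densely_defined H,
      forall f g, Brho2 rho f g -> H f g &
      forall f g, Brho2 rho f g -> adjoint H f g].

Definition domHk H (rho : R) (k : C) (f : R -> C) : Prop :=
  L2 f /\ exists h g, [/\ L2ext rho h, resolvent H (k ^+ 2) h g &
    f = proj rho g %[ae mu]].

(* T Y Gamma_1 f = Y Gamma_0 f in the coordinates given by Y, the common factor
   sqrt 2 being cancelled; the component at +rho comes first. *)
Definition boundary_matrix H (rho : R) (k : C) (T : 'M[C]_2) : Prop :=
  forall f, domHk H rho k f <->
    L2 f /\ exists u u1 u2 : R -> C,
      [/\ W22 rho u u1 u2, f = proj rho u %[ae mu] &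
          T *m col2 (u rho + u1 rho) (u (- rho) - u1 (- rho)) =
          2^-1 *: col2 (u rho) (u (- rho))].

Definition admissible_matrix H (rho : R) (k : C) : set 'M[C]_2 := [set T |
  boundary_matrix H rho k T /\
  1%:M - (2 * (1 + 'i * k)) *: T \in unitmx].

Definition Smatrix_exists H (rho : R) (k : C) : Prop :=
  exists T, admissible_matrix H rho k T.

Definition Smatrix H (rho : R) (k : C) : 'M[C]_2 :=
  let T := xget 0 (admissible_matrix H rho k) in
  (1%:M - (2 * (1 - 'i * k)) *: T) *m
  invmx (1%:M - (2 * (1 + 'i * k)) *: T).

Definition LambdaP H : set C :=
  [set k | [/\ 0 < Im k, Re k != 0 & resolvent_set H (k ^+ 2)]].

Definition h1 (rho : R) (k : C) : R -> C := fun x =>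
  if rho <= x then (k^* ^+ 2 - k ^+ 2) * cexp (- ('i * k^* * x%:C)) else 0.

Definition h2 (rho : R) (k : C) : R -> C := fun x =>
  if x <= - rho then (k^* ^+ 2 - k ^+ 2) * cexp ('i * k^* * x%:C) else 0.

Definition f1_form (rho : R) (k : C) (c : C * C) : R -> C := proj rho (fun x =>
  if rho <= x then cexp (- ('i * k^* * x%:C)) + c.1 * cexp ('i * k * x%:C)
  else c.2 * cexp (- ('i * k * x%:C))).

Definition f2_form (rho : R) (k : C) (c : C * C) : R -> C := proj rho (fun x =>
  if rho <= x then c.2 * cexp ('i * k * x%:C)
  else cexp ('i * k^* * x%:C) + c.1 * cexp (- ('i * k * x%:C))).

(* The pair (R_k^r, T_k^r), read off from P_rho (H - k^2)^-1 h_1. *)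
Definition right_coefs H (rho : R) (k : C) : C * C :=
  xget (0, 0) [set c | exists g, resolvent H (k ^+ 2) (h1 rho k) g /\
                         proj rho g = f1_form rho k c %[ae mu]].

(* The pair (R_k^l, T_k^l), read off from P_rho (H - k^2)^-1 h_2. *)
Definition left_coefs H (rho : R) (k : C) : C * C :=
  xget (0, 0) [set c | exists g, resolvent H (k ^+ 2) (h2 rho k) g /\
                         proj rho g = f2_form rho k c %[ae mu]].

Definition Rr H rho k : C := (right_coefs H rho k).1.
Definition Tr H rho k : C := (right_coefs H rho k).2.
Definition Rl H rho k : C := (left_coefs H rho k).1.
Definition Tl H rho k : C := (left_coefs H rho k).2.

Definition Delta H (rho : R) (k : C) : C :=
  let theta := 1 + 'i * k in
  let d := theta^* / theta * cexp (- (2 * 'i * rho%:C * (Re k)%:C)) in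
  \det (mat2 (Rr H rho k + d) (Tr H rho k) (Tl H rho k) (Rl H rho k + d)).

End Defs.

Arguments L2operator R : clear implicits.

(* Main.v *)
Require Import Defs.
From HB Require Import structures.
From mathcomp Require Import all_boot all_order all_algebra.
From mathcomp Require Import all_classical all_reals all_analysis.
From mathcomp Require Import measurable_realfun.
From mathcomp Require Import complex ring lra.

(* On the half-lines a function [f = P (H - k^2)^-1 h] of D(H_k) solves
   [- f'' - k^2 f = h]. As [Re k] is nonzero, the decaying exponentials
   [exp (- i k^* x)] and [exp (i k x)] have independent Cauchy data at [rho], and
   similarly at [- rho], so subtracting a combination of them leaves a function
   [u0] with zero Cauchy data, i.e. an element of D(B_rho^2), on which H and
   [- d^2/dx^2] agree. Since [- d^2/dx^2 - k^2] kills [exp (+- i k x)] and maps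
   [exp (-+ i k^* x)] to the data [h_1] and [h_2], this gives
   [h = (H - k^2) u0 + a h_1 + b h_2], whence D(H_k) is the sum of D(B_rho^2) and
   of the span of [f_1] and [f_2]. The boundary values of [f_1] and [f_2] are the
   columns of explicit matrices [G0] and [G1]; up to a nonzero factor [det G1] is
   [Delta_k], so [T_k = G0 G1^-1], and [G1 - 2 (1 + i k) G0] is a nonzero scalar
   matrix, which gives both the existence and the formula of [S(k)]. *)

Set Implicit Arguments.
Unset Strict Implicit.
Unset Printing Implicit Defensive.

Import Order.TTheory GRing.Theory Num.Theory.
Import numFieldNormedType.Exports.

Local Open Scope classical_set_scope.
Local Open Scope ring_scope.
Local Open Scope complex_scope.

(** Solutions supplied by [H] come with [u] and [u'' = - (h + z u)] square-integrable outside the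
    gap, whereas [W22] also asks for [u'] in L_2. Most of the real analysis closes this distance: an
    interpolation estimate bounds [u'] at a point by [u] there and by integrals of [u] and [u'']
    over a neighbouring segment of length 2, and Tonelli's theorem sums these local bounds. A second
    difficulty is that elements of the domains are classes modulo null sets while boundary
    conditions are pointwise; two [W22] representatives of one class are shown to agree on the whole
    exterior, end points included, together with their derivatives. The matrix [G1 - 2 (1 + i k) G0]
    is scalar because an outgoing exponential satisfies [f + f' = (1 + i k) f] at [rho] and
    [f - f' = (1 + i k) f] at [- rho]: this combination cancels every reflected and transmitted
    part. What remains is the incoming exponential of each wave, present at one end only and of the
    same size at either end. *)

Section almost_everywhere.
Context {R : realType}.
Local Notation mu := (@lebesgue_measure R).
Implicit Types P Q S : R -> Prop.

Lemma ae_filterS P Q : (forall x, P x -> Q x) ->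
  {ae mu, forall x, P x} -> {ae mu, forall x, Q x}.
Proof. by move=> PQ; apply: filterS => //; exact: (ae_filter_ringOfSetsType mu). Qed.

Lemma ae_filterS2 P Q S : (forall x, P x -> Q x -> S x) ->
  {ae mu, forall x, P x} -> {ae mu, forall x, Q x} -> {ae mu, forall x, S x}.
Proof. by move=> PQS; apply: filterS2 => //; exact: (ae_filter_ringOfSetsType mu). Qed.

End almost_everywhere.

(** * Primitives on the real line *)

Section real_primitives.
Context {R : realType}.
Local Notation mu := (@lebesgue_measure R).
Implicit Types (D : set R) (p q v w : R -> R).

Definition real_ac_deriv D p v := forall x y, x <= y -> `[x, y] `<=` D ->
  mu.-integrable `[x, y] (fun t => (v t)%:E) /\
  p y - p x = \int[mu]_(t in `[x, y]) v t.

Lemma ae_eq_integrable D v w : measurable D -> measurable_fun D w ->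
  {ae mu, forall x, D x -> v x = w x} ->
  mu.-integrable D (EFin \o v) -> mu.-integrable D (EFin \o w).
Proof.
move=> mD mw vw /integrableP[mv iv]; apply/integrableP; split.
  exact/measurable_EFinP.
apply: le_lt_trans iv; rewrite le_eqVlt; apply/orP; left; apply/eqP.
apply: ge0_ae_eq_integral => //.
- by apply: measurableT_comp => //; exact/measurable_EFinP.
- exact: measurableT_comp.
- by apply: ae_filterS vw => x vwx /= Dx; rewrite vwx.
Qed.

Lemma integrable_singleton (x : R) v : mu.-integrable [set x] (EFin \o v).
Proof.
apply/integrableP; split.
  by apply/measurable_EFinP; exact: measurable_fun_set1.
by rewrite integral_set1 ltry.
Qed.

Lemma real_ac_derivS D D' p v : D' `<=` D ->
  real_ac_deriv D p v -> real_ac_deriv D' p v.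
Proof. by move=> DD' pv x y xy xyD; apply: pv => //; exact: subset_trans DD'. Qed.

Lemma real_ac_deriv_continuous p v a b : a <= b ->
  real_ac_deriv `[a, b] p v -> {within `[a, b], continuous p}.
Proof.
move=> ab pv; have [iv _] := pv _ _ ab (@subset_refl _ _).
have cF := parameterized_integral_continuous ab iv.
apply: (@subspace_eq_continuous _ _ _
    (fun x => p a + \int[mu]_(t in `[a, x]) v t)); last first.
  by move=> x; apply: cvgD; [exact: cvg_cst|exact: cF].
move=> x /set_mem /=; rewrite in_itv/= => /andP[ax xb].
have [|_ <-] := pv a x ax; last by rewrite addrC subrK.
by apply: subset_itvl; rewrite bnd_simp.
Qed.

(** [p] differs by a constant from the integral of the continuous [v], so the first fundamental
    theorem upgrades the almost everywhere derivative to a classical one. *)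
Lemma real_ac_deriv_is_derive p v a b : real_ac_deriv `[a, b] p v ->
  {within `[a, b], continuous v} ->
  forall x, x \in `]a, b[ -> is_derive x 1 p (v x).
Proof.
move=> pv cv x xab; have /andP[ax xb] : a < x < b by rewrite in_itv in xab.
have ab := lt_trans ax xb.
have [iv _] := pv _ _ (ltW ab) (@subset_refl _ _).
have [cvi _ _] := (continuous_within_itvP v ab).1 cv.
have [dF F'] := continuous_FTC1_closed xb iv ax (cvi x xab).
pose F y := p a + \int[mu]_(t in `[a, y]) v t.
have -> : v x = 0 + v x by rewrite add0r.
apply: (@near_eq_is_derive _ _ _ F p); last first.
  apply: (@is_deriveD _ _ _ (cst (p a))).
  by apply: DeriveDef => //; rewrite -derive1E F'.
have /= := @near_in_itvoo _ a b x xab; apply: filterS => y.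
rewrite in_itv/= => /andP[ay yb].
have [|_ E] := pv a y (ltW ay); last by rewrite /F -E addrC subrK.
by apply: subset_itvl; rewrite bnd_simp ltW.
Qed.

Lemma continuous_itvoo_eq0 v a b : a < b -> {within `[a, b], continuous v} ->
  (forall x, x \in `]a, b[ -> v x = 0) -> forall x, x \in `[a, b] -> v x = 0.
Proof.
move=> ab /(continuous_within_itvP _ ab)[_ va vb] v0 x.
rewrite in_itv/= le_eqVlt => /andP[/predU1P[<- _|ax]].
  apply: (@cvg_unique _ _ (v @ a^'+)) => //.
  apply: cvg_near_cst; near=> y; apply: v0; rewrite in_itv/=; apply/andP.
  by split; near: y; [exact: nbhs_right_gt|exact: nbhs_right_lt].
rewrite le_eqVlt => /predU1P[->|xb]; last by rewrite v0// in_itv/= ax.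
apply: (@cvg_unique _ _ (v @ b^'-)) => //.
apply: cvg_near_cst; near=> y; apply: v0; rewrite in_itv/=; apply/andP.
by split; near: y; [exact: nbhs_left_gt|exact: nbhs_left_lt].
Unshelve. all: by end_near.
Qed.

Lemma real_ac_deriv_cst p v a b c : a < b -> real_ac_deriv `[a, b] p v ->
  {within `[a, b], continuous v} -> (forall x, x \in `[a, b] -> p x = c) ->
  forall x, x \in `[a, b] -> v x = 0.
Proof.
move=> ab pv cv pc; apply: continuous_itvoo_eq0 => // x xab.
have dp := real_ac_deriv_is_derive pv cv xab.
have dc : is_derive x (1 : R) p 0.
  apply: (@near_eq_is_derive _ _ _ (cst c) p).
  by have /= := @near_in_itvoo _ a b x xab; apply: filterS => y yab;
    rewrite pc//; exact: subset_itv_oo_cc yab.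
by rewrite -(@derive_val _ _ _ _ _ _ _ dp) (@derive_val _ _ _ _ _ _ _ dc).
Qed.

(** The integral of [v] over every subsegment is 0, so the zero function is a primitive of [v], and
    [real_ac_deriv_cst] applies to that constant primitive. *)
Lemma continuous_ae_eq0 v a b : a < b -> {within `[a, b], continuous v} ->
  {ae mu, forall x, x \in `[a, b] -> v x = 0} ->
  forall x, x \in `[a, b] -> v x = 0.
Proof.
move=> ab cv v0.
have iv : mu.-integrable `[a, b] (EFin \o v).
  by apply: continuous_compact_integrable => //; exact: segment_compact.
apply: (@real_ac_deriv_cst (cst 0) v a b 0) => // x y xy xyab; split.
  by apply: integrableS iv.
rewrite subrr /Rintegral (ae_eq_integral (cst 0%E))//= ?integral0//.
  by apply: measurable_funS (measurable_int mu iv).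
by apply: ae_filterS v0 => t vt /= txy; congr EFin; apply: vt; exact: xyab.
Qed.

Lemma is_derive_real_ac_deriv D p v : (forall x, is_derive x (1 : R) p (v x)) ->
  continuous v -> real_ac_deriv D p v.
Proof.
move=> dp cv x y; rewrite le_eqVlt => /predU1P[<- _|xy _].
  by rewrite set_itv1 Rintegral_set1 subrr; split => //; exact: integrable_singleton.
have cp : continuous p.
  by move=> t; apply/differentiable_continuous/derivable1_diffP; case: (dp t).
split.
  apply: continuous_compact_integrable; first exact: segment_compact.
  exact: continuous_subspaceT.
rewrite /Rintegral (@continuous_FTC2 _ v p)//=.
- exact: continuous_subspaceT.
- split; first by move=> t _; case: (dp t).
    by apply: cvg_at_right_filter; exact: cp.
  by apply: cvg_at_left_filter; exact: cp.
- by move=> t _; rewrite derive1E; exact: derive_val.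
Qed.

Lemma real_ac_deriv_lin D p v q w (a b : R) : real_ac_deriv D p v ->
  real_ac_deriv D q w ->
  real_ac_deriv D (fun x => a * p x + b * q x) (fun x => a * v x + b * w x).
Proof.
move=> pv qw x y xy xyD; have [iv Ev] := pv x y xy xyD.
have [iw Ew] := qw x y xy xyD.
have iav : mu.-integrable `[x, y] (EFin \o (fun t => a * v t)).
  by apply: eq_integrable (integrableZl _ a iv).
have ibw : mu.-integrable `[x, y] (EFin \o (fun t => b * w t)).
  by apply: eq_integrable (integrableZl _ b iw).
split.
  by apply: eq_integrable (integrableD _ iav ibw).
by rewrite RintegralD// !RintegralZl// -Ev -Ew; ring.
Qed.

(** Equality almost everywhere does not transport measurability, which integrability includes; hence
    the assumption on [w]. *)
Lemma real_ac_deriv_ae D p v w : measurable_fun setT w ->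
  {ae mu, forall x, D x -> v x = w x} ->
  real_ac_deriv D p v -> real_ac_deriv D p w.
Proof.
move=> mw vw pv x y xy xyD; have [iv Ev] := pv x y xy xyD.
have mv := measurable_int mu iv.
have mw' : measurable_fun `[x, y] w by exact: measurable_funTS.
have aevw : ae_eq mu `[x, y]%classic (EFin \o v) (EFin \o w).
  by apply: ae_filterS vw => t vt /= txy; congr EFin; apply: vt; exact: xyD.
have vw' : {ae mu, forall t, `[x, y]%classic t -> v t = w t}.
  by apply: ae_filterS vw => t vt /= txy; apply: vt; exact: xyD.
split; first exact: (ae_eq_integrable _ mw' vw').
by rewrite Ev /Rintegral; congr fine; apply: ae_eq_integral => //; exact/measurable_EFinP.
Qed.

End real_primitives.

(** * Square-integrable functions and interpolation of derivatives *)

Section real_L2.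
Context {R : realType}.
Local Notation mu := (@lebesgue_measure R).
Implicit Types (D : set R) (p q v w phi : R -> R).

Lemma Lfun2P phi : phi \in Lfun mu 2%:E <->
  measurable_fun setT phi /\ (\int[mu]_x ((phi x) ^+ 2)%:E < +oo)%E.
Proof.
split=> [phi2|[mphi phi2]].
  have /[!inE] mphi := sub_Lfun_mfun phi2; split => //.
  have /integrableP[_] := Lfun2_integrable_sqr phi2; apply: le_lt_trans.
  by rewrite le_eqVlt; apply/orP; left; apply/eqP; apply: eq_integral => x _ /=;
    rewrite ger0_norm// sqr_ge0.
rewrite inE; apply/andP; split; first by rewrite inE.
rewrite inE /= /finite_norm unlock /=; apply: poweR_lty.
apply: le_lt_trans phi2; rewrite le_eqVlt; apply/orP; left; apply/eqP.
by apply: eq_integral => x _; rewrite /= powR_mulrn// real_normK// num_real.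
Qed.

Lemma Lfun2_dominated phi (G : R -> \bar R) : measurable_fun setT phi ->
  measurable_fun setT G -> (forall x, ((phi x) ^+ 2)%:E <= G x)%E ->
  (\int[mu]_x G x < +oo)%E -> phi \in Lfun mu 2%:E.
Proof.
move=> mphi mG phiG iG; apply/Lfun2P; split => //.
apply: le_lt_trans iG; apply: ge0_le_integral => //.
- by move=> x _; rewrite lee_fin sqr_ge0.
- by apply/measurable_EFinP; exact: measurable_funX.
Qed.

(* [0 <= \int (`|v| - m / l) ^ 2], where [m] is the integral of [`|v|] and [l]
   the length of the segment. *)
Lemma sqr_Rintegral_le v (a b : R) : a < b ->
  mu.-integrable `[a, b] (EFin \o v) ->
  mu.-integrable `[a, b] (fun t => (v t ^+ 2)%:E) ->
  (\int[mu]_(t in `[a, b]) `|v t|) ^+ 2 <=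
    (b - a) * \int[mu]_(t in `[a, b]) (v t ^+ 2).
Proof.
move=> ab iv iv2; set m := \int[mu]_(t in _) _; set s := \int[mu]_(t in _) _.
have iav : mu.-integrable `[a, b] (EFin \o (fun t => `|v t|)).
  exact: (integrable_abse iv).
have muab : mu `[a, b] = (b - a)%:E.
  by rewrite lebesgue_measure_itv /= lte_fin ab EFinB.
have ic (c : R) : mu.-integrable `[a, b] (EFin \o (fun=> c)).
  apply: continuous_compact_integrable; first exact: segment_compact.
  by apply: continuous_subspaceT => x; exact: cvg_cst.
set c := m / (b - a); have ba : b - a != 0 by rewrite subr_eq0 gt_eqF.
have icv : mu.-integrable `[a, b] (EFin \o (fun t => - (2 * c) * `|v t|)).
  by apply: eq_integrable (integrableZl _ (- (2 * c)) iav).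
have i2 : mu.-integrable `[a, b] (EFin \o (fun t => v t ^+ 2 + - (2 * c) * `|v t|)).
  by apply: eq_integrable (integrableD _ iv2 icv).
have : 0 <= \int[mu]_(t in `[a, b]) (v t ^+ 2 + - (2 * c) * `|v t| + c ^+ 2).
  apply: Rintegral_ge0 => t _.
  rewrite -(real_normK (num_real (v t))).
  by rewrite (_ : _ + _ = (`|v t| - c) ^+ 2) ?sqr_ge0//; ring.
rewrite RintegralD// RintegralD// RintegralZl// Rintegral_cst//.
rewrite (_ : fine _ = b - a); last by rewrite [X in fine X]muab.
rewrite -/m -/s (_ : s + _ + _ = s - m ^+ 2 / (b - a)); last by rewrite /c; field.
by rewrite subr_ge0 ler_pdivrMr ?subr_gt0// mulrC.
Qed.

(** Written as an integral over the whole line with a cut-off, so that it is the partial integral of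
    a kernel on the plane, to which Tonelli's theorem applies. The radius 2 is the length of the
    segments in the interpolation estimate. *)
Definition local_energy phi (x : R) : \bar R :=
  (\int[mu]_t (if `|x - t| <= 2 then phi t ^+ 2 else 0)%:E)%E.

Lemma local_energy_ge0 phi x : (0 <= local_energy phi x)%E.
Proof.
by apply: integral_ge0 => t _; rewrite lee_fin; case: ifP => // _; exact: sqr_ge0.
Qed.

Let kernel phi (z : R * R) : \bar R :=
  (if `|z.1 - z.2| <= 2 then phi z.2 ^+ 2 else 0)%:E.

Let measurable_kernel phi : measurable_fun setT phi ->
  measurable_fun setT (kernel phi).
Proof.
move=> mphi; apply/measurable_EFinP; apply: measurable_fun_ifT => //=.
  apply: measurable_fun_ler => //; apply: measurableT_comp => //.
  by apply: measurable_funB.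
by apply: measurable_funX; apply: measurableT_comp.
Qed.

Lemma measurable_local_energy phi : measurable_fun setT phi ->
  measurable_fun setT (local_energy phi).
Proof.
move=> /measurable_kernel mk.
apply: (@measurable_fun_fubini_tonelli_F _ _ _ _ _ mu _ mk).
by move=> z; rewrite lee_fin; case: ifP => // _; exact: sqr_ge0.
Qed.

(** After exchanging the integrals, each [t] is counted for the [x] in [[t - 2, t + 2]], so the
    total is 4 times the integral of [phi ^ 2]. *)
Lemma integral_local_energy_lty phi : phi \in Lfun mu 2%:E ->
  (\int[mu]_x local_energy phi x < +oo)%E.
Proof.
move=> /Lfun2P[mphi phi2].
have kernel_ge0 z : (0 <= kernel phi z)%E.
  by rewrite lee_fin; case: ifP => // _; exact: sqr_ge0.
have kernelE (t : R) : (\int[mu]_x kernel phi (x, t) = (4 * phi t ^+ 2)%:E)%E.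
  transitivity (\int[mu]_(x in `[(t - 2)%R, (t + 2)%R]) (phi t ^+ 2)%:E)%E.
    rewrite [RHS]integral_mkcond; apply: eq_integral => x _.
    rewrite patchE /kernel /= mem_setE/= in_itv/= ler_norml.
    by rewrite lerBlDr lerBrDr addrC [2 + t]addrC; case: ifP.
  have muI : mu `[(t - 2)%R, (t + 2)%R]%classic = 4%:E.
    rewrite lebesgue_measure_itv /= lte_fin ifT; last lra.
    by rewrite -EFinB; congr (_%:E); ring.
  by rewrite integral_cst// [X in (_ * X)%E]muI -EFinM mulrC.
have -> : (\int[mu]_x local_energy phi x = \int[mu]_t (4 * phi t ^+ 2)%:E)%E.
  transitivity (\int[mu]_t \int[mu]_x kernel phi (x, t))%E.
    exact: (@fubini_tonelli _ _ _ _ _ mu mu _ (measurable_kernel mphi)).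
  by apply: eq_integral => t _; exact: kernelE.
under eq_integral do rewrite EFinM.
rewrite ge0_integralZl//; first by rewrite lte_mul_pinfty.
  by apply/measurable_EFinP; exact: measurable_funX.
by move=> x _; rewrite lee_fin sqr_ge0.
Qed.

End real_L2.

(** * Control of the first derivative by the function and its second derivative *)

Section interpolation.
Context {R : realType}.
Local Notation mu := (@lebesgue_measure R).
Implicit Types (D : set R) (p v w : R -> R).

Lemma subset_itvcc (a b x y : R) : x \in `[a, b] -> y \in `[a, b] ->
  `[x, y] `<=` `[a, b].
Proof.
rewrite !in_itv/= => /andP[ax _] /andP[_ yb] t /=; rewrite !in_itv/=.
by move=> /andP[xt ty]; rewrite (le_trans ax)// (le_trans ty).
Qed.

Lemma real_ac_deriv_osc v w (a b x y : R) : real_ac_deriv `[a, b] v w ->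
  x \in `[a, b] -> y \in `[a, b] ->
  `|v y - v x| <= \int[mu]_(t in `[a, b]) `|w t|.
Proof.
move=> vw; wlog xy : x y / x <= y.
  move=> H xab yab; have [xy|/ltW yx] := leP x y; first exact: H.
  by rewrite distrC; exact: H.
move=> xab yab; have ab : a <= b.
  by move: xab; rewrite in_itv/= => /andP[]; exact: le_trans.
have [iw _] := vw _ _ ab (@subset_refl _ _).
have xyab := subset_itvcc xab yab.
have [iw' ->] := vw _ _ xy xyab.
apply: le_trans (le_normr_Rintegral _ iw') _ => //.
have iaw : mu.-integrable `[a, b] (EFin \o (fun t => `|w t|)).
  exact: (integrable_abse iw).
have iaw' : mu.-integrable `[x, y] (EFin \o (fun t => `|w t|)).
  exact: integrableS iaw.
rewrite fine_le ?integrable_fin_num//.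
apply: ge0_subset_integral => //.
exact: measurable_int iaw.
Qed.

(** By the mean value theorem the slope between [x] and [y] is [v c] for some [c]; it is at most
    [|p x| + |p y|] in modulus because the points are at distance at least 1. Passing from [c] to
    [x] costs at most the integral of [|w|]. *)
Lemma derivative_le p v w (a b x y : R) : real_ac_deriv `[a, b] p v ->
  real_ac_deriv `[a, b] v w -> x \in `[a, b] -> y \in `[a, b] ->
  1 <= `|y - x| ->
  `|v x| <= `|p x| + `|p y| + \int[mu]_(t in `[a, b]) `|w t|.
Proof.
move=> pv vw xab yab xy1; have ab : a <= b.
  by move: xab; rewrite in_itv/= => /andP[]; exact: le_trans.
have cp := real_ac_deriv_continuous ab pv.
have cv := real_ac_deriv_continuous ab vw.
have [c cab E] : exists2 c, c \in `[a, b] & p y - p x = v c * (y - x).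
  wlog xy : x y xab yab {xy1} / x <= y.
    move=> H; have [xy|/ltW yx] := leP x y; first exact: H.
    have [c cab E] := H _ _ yab xab yx.
    by exists c => //; rewrite -[LHS]opprB E -mulrN opprB.
  have xyab := subset_itvcc xab yab.
  have [c cxy E] := @MVT_segment R p v x y xy
    (real_ac_deriv_is_derive (real_ac_derivS xyab pv)
      (continuous_subspaceW xyab cv))
    (continuous_subspaceW xyab cp).
  by exists c => //; exact: xyab.
have vc : `|v c| <= `|p x| + `|p y|.
  have : `|v c| * 1 <= `|v c| * `|y - x| by rewrite ler_wpM2l.
  rewrite -normrM -E mulr1 => /le_trans; apply.
  by rewrite [leRHS]addrC; exact: ler_normB.
rewrite -[v x](subrK (v c)) addrC (le_trans (ler_normD _ _))// lerD//.
exact: (real_ac_deriv_osc vw).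
Qed.

Lemma integrable_sqr_le phi D : measurable D -> phi \in Lfun mu 2%:E ->
  mu.-integrable D (fun t => (phi t ^+ 2)%:E).
Proof.
by move=> mD /Lfun2_integrable_sqr; apply: integrableS.
Qed.

Lemma Rintegral_le_local_energy phi (a b x : R) : phi \in Lfun mu 2%:E ->
  (forall t, t \in `[a, b] -> `|x - t| <= 2) ->
  ((\int[mu]_(t in `[a, b]) (phi t ^+ 2))%:E <= local_energy phi x)%E.
Proof.
move=> phi2 abx; have /Lfun2P[mphi _] := phi2.
rewrite /Rintegral fineK; last first.
  by apply: integrable_fin_num => //; exact: integrable_sqr_le.
rewrite integral_mkcond; apply: ge0_le_integral => //.
- by move=> t _; apply: erestrict_ge0 => s _; rewrite lee_fin sqr_ge0.
- apply/(measurable_restrictT _ _).1 => //; apply/measurable_EFinP.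
  by apply: measurable_funTS; exact: measurable_funX.
- apply/measurable_EFinP; apply: measurable_fun_ifT => //=.
    apply: measurable_fun_ler => //; apply: measurableT_comp => //.
    exact: measurable_funB.
  exact: measurable_funX.
- move=> t _; rewrite patchE mem_setE; case: ifPn => [tab|_]; last first.
    by rewrite lee_fin; case: ifP => // _; exact: sqr_ge0.
  by rewrite abx.
Qed.

(** The bound of [derivative_le] is squared and averaged over the [y] in the unit half of the
    segment away from [x]. The 3 comes from squaring a sum of three terms, the 2 is the length of
    the segment in the Cauchy-Schwarz bound for the integral of [|w|]. *)
Lemma sqr_derivative_le p v w (a x : R) :
  mu.-integrable `[a, a + 2] (fun t => (w t ^+ 2)%:E) ->
  real_ac_deriv `[a, a + 2] p v -> real_ac_deriv `[a, a + 2] v w ->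
  x = a \/ x = a + 2 ->
  v x ^+ 2 <= 3 * (p x ^+ 2 + \int[mu]_(t in `[a, a + 2]) (p t ^+ 2) +
                   2 * \int[mu]_(t in `[a, a + 2]) (w t ^+ 2)).
Proof.
move=> iw2 pv vw xa; have a2 : a < a + 2 by rewrite ltrDl.
have xI : x \in `[a, a + 2].
  by rewrite in_itv/=; case: xa => ->; rewrite lexx ltW.
set A := \int[mu]_(t in _) (w t ^+ 2).
have [iw _] := vw _ _ (ltW a2) (@subset_refl _ _).
have wA := sqr_Rintegral_le a2 iw iw2.
rewrite -/A (_ : a + 2 - a = 2) in wA; last by ring.
set B := \int[mu]_(t in _) `|w t| in wA.
have [c [ac cb far]] : exists c, [/\ a <= c, c + 1 <= a + 2 &
    forall y, y \in `[c, c + 1] -> 1 <= `|y - x|].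
  case: xa => ->; [exists (a + 1)|exists a]; split; try lra.
    move=> y; rewrite in_itv/= => /andP[ya _]; rewrite ger0_norm; lra.
  move=> y; rewrite in_itv/= => /andP[_ ya]; rewrite ler0_norm; lra.
have sub : `[c, c + 1] `<=` `[a, a + 2] by apply: subset_itv; rewrite bnd_simp.
have cp2 : {within `[a, a + 2], continuous (fun t => p t ^+ 2)}.
  have cp := real_ac_deriv_continuous (ltW a2) pv.
  rewrite (_ : (fun t => _) = (fun t => p t * p t)).
    by move=> t; apply: cvgM; exact: cp.
  by apply/funext => t; rewrite expr2.
have ip2 : mu.-integrable `[a, a + 2] (EFin \o (fun t => p t ^+ 2)).
  by apply: continuous_compact_integrable => //; exact: segment_compact.
have ip2' : mu.-integrable `[c, c + 1] (EFin \o (fun t => p t ^+ 2)).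
  exact: integrableS ip2.
have le1 : v x ^+ 2 / 3 - p x ^+ 2 - 2 * A <= \int[mu]_(t in `[c, c + 1]) (p t ^+ 2).
  (* The unit segment has measure 1, so the left side, constant in [y], equals its own integral and
     a pointwise comparison suffices. *)
  rewrite -[leLHS]mulr1.
  have mu1 : fine (mu `[c, c + 1]%classic) = 1.
    by rewrite lebesgue_measure_itv /= lte_fin ltrDl ltr01 -EFinB /=; ring.
  rewrite -[X in _ * X]mu1 -Rintegral_cst//; apply: le_Rintegral => //.
    apply: continuous_compact_integrable; first exact: segment_compact.
    by apply: continuous_subspaceT => t; exact: cvg_cst.
  move=> y yc; have := derivative_le pv vw xI (sub _ yc) (far _ yc).
  rewrite -/B -(real_normK (num_real (v x))) -(real_normK (num_real (p x))).
  rewrite -(real_normK (num_real (p y))).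
  have := normr_ge0 (v x); have := normr_ge0 (p x); have := normr_ge0 (p y).
  move: `|v x| `|p x| `|p y| => V P Q Q0 P0 V0 VB.
  have B0 : 0 <= B by apply: Rintegral_ge0.
  have : V ^+ 2 <= (P + Q + B) ^+ 2 by rewrite lerXn2r// nnegrE !addr_ge0.
  (* These squares give [(P + Q + B)^2 <= 3 (P^2 + Q^2 + B^2)], and [wA] bounds [B^2] by [2 A]. *)
  have := sqr_ge0 (P - Q); have := sqr_ge0 (P - B); have := sqr_ge0 (Q - B).
  move: wA; nra.
have : \int[mu]_(t in `[c, c + 1]) (p t ^+ 2) <=
       \int[mu]_(t in `[a, a + 2]) (p t ^+ 2).
  rewrite fine_le ?integrable_fin_num//; apply: ge0_subset_integral => //.
    exact: measurable_int ip2.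
  by move=> t _; rewrite lee_fin sqr_ge0.
move: le1; lra.
Qed.

(* At each point the derivative is controlled by the values of the function and
   of its second derivative on a segment of length 2 contained in [D], hence by
   local energies, which are integrable by Tonelli's theorem. *)
Lemma Lfun2_derivative D p v w : measurable D ->
  (forall x, D x -> `[x, x + 2] `<=` D \/ `[x - 2, x] `<=` D) ->
  real_ac_deriv D p v -> real_ac_deriv D v w ->
  measurable_fun D v ->
  p \_ D \in Lfun mu 2%:E -> w \_ D \in Lfun mu 2%:E ->
  v \_ D \in Lfun mu 2%:E.
Proof.
move=> mD sD pv vw mv p2 w2.
have [mp ip] := (Lfun2P _).1 p2; have [mw iw] := (Lfun2P _).1 w2.
pose G x := (3%:E * (((p \_ D) x ^+ 2)%:E + local_energy (p \_ D) x +
                    2%:E * local_energy (w \_ D) x))%E.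
have mp2 : measurable_fun setT (fun x => ((p \_ D) x ^+ 2)%:E).
  by apply/measurable_EFinP; exact: measurable_funX.
have p2_ge0 x : (0 <= ((p \_ D) x ^+ 2)%:E)%E by rewrite lee_fin sqr_ge0.
have mEp := measurable_local_energy mp; have mEw := measurable_local_energy mw.
have Ep0 := @local_energy_ge0 R (p \_ D); have Ew0 := @local_energy_ge0 R (w \_ D).
have mpE : measurable_fun setT
    (fun x => ((p \_ D) x ^+ 2)%:E + local_energy (p \_ D) x)%E.
  exact: emeasurable_funD.
have mwE : measurable_fun setT (fun x => 2%:E * local_energy (w \_ D) x)%E.
  exact: measurable_funeM.
have mG : measurable_fun setT (fun x => ((p \_ D) x ^+ 2)%:E +
    local_energy (p \_ D) x + 2%:E * local_energy (w \_ D) x)%E.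
  exact: emeasurable_funD.
have two_ge0 : (0 <= 2%:E :> \bar R)%E by rewrite lee_fin.
have inner_ge0 x : (0 <= ((p \_ D) x ^+ 2)%:E + local_energy (p \_ D) x +
    2%:E * local_energy (w \_ D) x)%E.
  by apply: adde_ge0; [exact: adde_ge0|exact: mule_ge0].
apply: (@Lfun2_dominated _ _ G).
- exact/(measurable_restrictT _ _).1.
- exact: measurable_funeM.
- move=> x; rewrite patchE; case: ifPn => [/set_mem Dx|_]; last first.
    by rewrite expr0n /= mule_ge0// lee_fin.
  have [a [xa aD]] : exists a, (x = a \/ x = a + 2) /\ `[a, a + 2] `<=` D.
    have [xD|xD] := sD x Dx; first by exists x; split; [left|].
    by exists (x - 2); split; [right|]; rewrite subrK.
  have near t : t \in `[a, a + 2] -> `|x - t| <= 2.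
    rewrite in_itv/= ler_norml => /andP[? ?]; apply/andP; case: xa => ->; lra.
  have rE (f : R -> R) : {in `[a, a + 2]%classic, (fun t => (f \_ D) t ^+ 2) =1
      (fun t => f t ^+ 2)}.
    by move=> t /set_mem /aD Dt; rewrite patchE mem_set.
  have rI (f : R -> R) : \int[mu]_(t in `[a, a + 2]) (f t ^+ 2) =
      \int[mu]_(t in `[a, a + 2]) ((f \_ D) t ^+ 2).
    by apply: eq_Rintegral => t tI; rewrite rE.
  have iw2 : mu.-integrable `[a, a + 2] (fun t => (w t ^+ 2)%:E).
    apply: eq_integrable (integrable_sqr_le (measurable_itv _) w2) => //.
    by move=> t tab; rewrite rE.
  have := sqr_derivative_le iw2 (real_ac_derivS aD pv) (real_ac_derivS aD vw) xa.
  rewrite -lee_fin => /le_trans; apply.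
  rewrite EFinM !EFinD (EFinM 2 (Rintegral _ _ _)).
  apply: lee_wpmul2l; first by rewrite lee_fin.
  apply: leeD; last first.
    apply: lee_wpmul2l => //; rewrite rI.
    exact: Rintegral_le_local_energy.
  apply: leeD; first by rewrite patchE mem_set.
  rewrite rI.
  exact: Rintegral_le_local_energy.
- rewrite ge0_integralZl//.
  rewrite lte_mul_pinfty// ge0_integralD//; last 2 first.
  + by move=> x _; exact: adde_ge0.
  + by move=> x _; exact: mule_ge0.
  rewrite lte_add_pinfty//; first rewrite ge0_integralD//.
    by rewrite lte_add_pinfty// integral_local_energy_lty.
  by rewrite ge0_integralZl// lte_mul_pinfty// integral_local_energy_lty.
Qed.

End interpolation.

(** * Complex-valued functions *)

Section complex_valued.
Context {R : realType}.
Local Notation C := R[i].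
Local Notation Re := (@complex.Re R).
Local Notation Im := (@complex.Im R).
Local Notation "''i'" := ('i%C : C) : ring_scope.
Local Notation "z ^*" := (conjc z) : ring_scope.
Local Notation mu := (@lebesgue_measure R).
Local Notation proj := Defs.proj.
Implicit Types (D : set R) (u v w f g h : R -> C) (z a b c : C).

Lemma complex_eq a b : Re a = Re b -> Im a = Im b -> a = b.
Proof. by case: a b => [? ?] [? ?] /= -> ->. Qed.

Lemma complex_ReD a b : Re (a + b) = Re a + Re b.
Proof. by case: a b => [? ?] []. Qed.

Lemma complex_ImD a b : Im (a + b) = Im a + Im b.
Proof. by case: a b => [? ?] []. Qed.

Lemma complex_ReN a : Re (- a) = - Re a. Proof. by case: a. Qed.

Lemma complex_ImN a : Im (- a) = - Im a. Proof. by case: a. Qed.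

Lemma complex_ReM a b : Re (a * b) = Re a * Re b - Im a * Im b.
Proof. by case: a b => [? ?] []. Qed.

Lemma complex_ImM a b : Im (a * b) = Re a * Im b + Im a * Re b.
Proof. by case: a b => [? ?] []. Qed.

Definition complex_partE := (complex_ReD, complex_ImD, complex_ReN, complex_ImN,
  complex_ReM, complex_ImM).

Lemma aeP f g : f = g %[ae mu] <-> {ae mu, forall x, f x = g x}.
Proof. by split; apply: ae_filterS => x; [apply|move=> ->]. Qed.

Lemma ac_derivP D u v : ac_deriv D u v <->
  real_ac_deriv D (Re \o u) (Re \o v) /\ real_ac_deriv D (Im \o u) (Im \o v).
Proof.
split=> [uv|[reuv imuv] x y xy xyD].
  by split=> x y xy xyD; have [[? ?] E] := uv x y xy xyD; split => //=;
    rewrite -!complex_partE E.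
have [iRe ERe] := reuv x y xy xyD; have [iIm EIm] := imuv x y xy xyD.
by split => //; apply: complex_eq; rewrite !complex_partE /= -?ERe -?EIm.
Qed.

Lemma ac_derivS D D' u v : D' `<=` D -> ac_deriv D u v -> ac_deriv D' u v.
Proof. by move=> DD' uv x y xy xyD; apply: uv => //; exact: subset_trans DD'. Qed.

Lemma ac_deriv_lin D a u v f g : ac_deriv D u v -> ac_deriv D f g ->
  ac_deriv D (fun x => a * u x + f x) (fun x => a * v x + g x).
Proof.
move=> /ac_derivP[ru iu] /ac_derivP[rf jf]; apply/ac_derivP; split.
  have := real_ac_deriv_lin 1 1 (real_ac_deriv_lin (Re a) (- Im a) ru iu) rf.
  by congr real_ac_deriv; apply/funext => x /=; rewrite !complex_partE; ring.
have := real_ac_deriv_lin 1 1 (real_ac_deriv_lin (Im a) (Re a) ru iu) jf.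
by congr real_ac_deriv; apply/funext => x /=; rewrite !complex_partE; ring.
Qed.

Lemma eq_ac_deriv D u v f g : (forall x, D x -> u x = f x) ->
  (forall x, D x -> v x = g x) -> ac_deriv D u v -> ac_deriv D f g.
Proof.
move=> uf vg uv x y xy xyD; have [[iR iI] E] := uv x y xy xyD.
have vg' : {in `[x, y]%classic, v =1 g} by move=> t /set_mem /xyD /vg.
rewrite -!uf; last 2 first.
- by apply: xyD; rewrite /= in_itv/= lexx xy.
- by apply: xyD; rewrite /= in_itv/= lexx xy.
split; first split.
- by apply: eq_integrable iR => // t txy /=; rewrite vg'.
- by apply: eq_integrable iI => // t txy /=; rewrite vg'.
- by rewrite E; apply: complex_eq; apply: eq_Rintegral => t txy; rewrite /= vg'.
Qed.

Definition cmeasurable f := measurable_fun setT (Re \o f) /\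
  measurable_fun setT (Im \o f).

Lemma ac_deriv_ae D u v w : cmeasurable w ->
  {ae mu, forall x, D x -> v x = w x} -> ac_deriv D u v -> ac_deriv D u w.
Proof.
move=> [mr mi] vw /ac_derivP[ru iu]; apply/ac_derivP; split.
  by apply: real_ac_deriv_ae ru => //; apply: ae_filterS vw => x /= vw /vw ->.
by apply: real_ac_deriv_ae iu => //; apply: ae_filterS vw => x /= vw /vw ->.
Qed.

Lemma L2_measurable f : L2 f -> cmeasurable f.
Proof. by case=> /Lfun2P[? _] /Lfun2P[]. Qed.

Lemma L2_lin a f g : L2 f -> L2 g -> L2 (fun x => a * f x + g x).
Proof.
have two : (1 <= 2%:E :> \bar R)%E by rewrite lee_fin ler1n.
have lin (r s : R) (p q t : R -> R) : p \in Lfun mu 2%:E -> q \in Lfun mu 2%:E ->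
    t \in Lfun mu 2%:E -> (fun x => r * p x + s * q x + t x) \in Lfun mu 2%:E.
  move=> p2 q2 t2; have [_ addL] := Lfun_addr_closed mu two.
  rewrite (_ : (fun x => _) = (r \o* p) + (s \o* q) + t); last first.
    apply/funext => x.
    by change (r * p x + s * q x + t x = p x * r + q x * s + t x); ring.
  by apply: (addL) => //; apply: (addL); apply: Lfun_scale => //; exact: ler1n.
move=> [rf jf] [rg ig]; split.
  rewrite (_ : (fun x => _) =
      (fun x => Re a * Re (f x) + - Im a * Im (f x) + Re (g x))); first exact: lin.
  by apply/funext => x /=; rewrite !complex_partE; ring.
rewrite (_ : (fun x => _) =
    (fun x => Re a * Im (f x) + Im a * Re (f x) + Im (g x))); first exact: lin.
by apply/funext => x /=; rewrite !complex_partE; ring.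
Qed.

Lemma L2_0 : L2 (fun=> 0 : C).
Proof.
by split; apply/Lfun2P; split => //=; rewrite expr0n /= integral0 ltry.
Qed.

Lemma L2_scale a f : L2 f -> L2 (fun x => a * f x).
Proof.
move=> /(L2_lin a) /(_ L2_0); congr L2; apply/funext => x.
by rewrite addr0.
Qed.

Lemma L2_ae f g : L2 f -> cmeasurable g -> f = g %[ae mu] -> L2 g.
Proof.
move=> [/Lfun2P[mr ir] /Lfun2P[mi ii]] [mgr mgi] /aeP fg.
split; apply/Lfun2P; split=> //.
  apply: le_lt_trans ir; rewrite le_eqVlt; apply/orP; left; apply/eqP.
  apply: ge0_ae_eq_integral => //.
  - by apply/measurable_EFinP; exact: measurable_funX.
  - by apply/measurable_EFinP; exact: measurable_funX.
  - by move=> x _; rewrite lee_fin sqr_ge0.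
  - by move=> x _; rewrite lee_fin sqr_ge0.
  - by apply: ae_filterS fg => x /= -> _.
apply: le_lt_trans ii; rewrite le_eqVlt; apply/orP; left; apply/eqP.
apply: ge0_ae_eq_integral => //.
- by apply/measurable_EFinP; exact: measurable_funX.
- by apply/measurable_EFinP; exact: measurable_funX.
- by move=> x _; rewrite lee_fin sqr_ge0.
- by move=> x _; rewrite lee_fin sqr_ge0.
- by apply: ae_filterS fg => x /= -> _.
Qed.

Section projection.
Variable rho : R.

Lemma measurable_ext : measurable (ext rho).
Proof.
have mn : measurable_fun setT (fun x : R => `|x|) by exact: measurableT_comp.
have mr : measurable_fun setT (cst rho : R -> R) by [].
have := measurable_fun_ler mr mn measurableT (Y := [set true]).
by rewrite setTI; apply.
Qed.

Lemma Re_proj f : Re \o proj rho f = (Re \o f) \_ (ext rho).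
Proof.
apply/funext => x; rewrite /= /proj patchE.
by case: ifPn => xr; [rewrite mem_set|rewrite memNset//; exact/negP].
Qed.

Lemma Im_proj f : Im \o proj rho f = (Im \o f) \_ (ext rho).
Proof.
apply/funext => x; rewrite /= /proj patchE.
by case: ifPn => xr; [rewrite mem_set|rewrite memNset//; exact/negP].
Qed.

Lemma projE f x : ext rho x -> proj rho f x = f x.
Proof. by rewrite /ext /proj /= => ->. Qed.

Lemma proj_lin a f g : proj rho (fun x => a * f x + g x) =
  (fun x => a * proj rho f x + proj rho g x).
Proof. by apply/funext => x; rewrite /proj; case: ifP; rewrite ?mulr0 ?addr0. Qed.

Lemma cmeasurable_proj f : cmeasurable f -> cmeasurable (proj rho f).
Proof.
move=> [mr mi]; have mext := measurable_ext.
split.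
  rewrite Re_proj; apply/(measurable_restrictT _ _).1 => //.
  exact: measurable_funTS.
rewrite Im_proj; apply/(measurable_restrictT _ _).1 => //.
exact: measurable_funTS.
Qed.

Lemma L2_proj f : L2 f -> L2 (proj rho f).
Proof.
move=> [rf jf]; have [mr ir] := (Lfun2P _).1 rf; have [mi ii] := (Lfun2P _).1 jf.
have [mpr mpi] := cmeasurable_proj (L2_measurable (conj rf jf)).
have le0 (p : R -> R) x : (((p \_ (ext rho)) x ^+ 2)%:E <= (p x ^+ 2)%:E)%E.
  by rewrite lee_fin patchE; case: ifP => // _; rewrite expr0n/= sqr_ge0.
split.
  apply: (@Lfun2_dominated _ _ (fun x => (Re (f x) ^+ 2)%:E)) ir => //.
    by apply/measurable_EFinP; exact: measurable_funX.
  by move=> x; have := congr1 (fun F => F x) (Re_proj f) => /= ->; exact: le0.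
apply: (@Lfun2_dominated _ _ (fun x => (Im (f x) ^+ 2)%:E)) ii => //.
  by apply/measurable_EFinP; exact: measurable_funX.
by move=> x; have := congr1 (fun F => F x) (Im_proj f) => /= ->; exact: le0.
Qed.

Lemma W22_lin a u u1 u2 v v1 v2 : W22 rho u u1 u2 -> W22 rho v v1 v2 ->
  W22 rho (fun x => a * u x + v x) (fun x => a * u1 x + v1 x)
    (fun x => a * u2 x + v2 x).
Proof.
move=> [? ? ? ? ?] [? ? ? ? ?].
by split; rewrite ?proj_lin; try exact: L2_lin; exact: ac_deriv_lin.
Qed.

End projection.

End complex_valued.

(** * Exponentials on half-lines *)

Section exponentials.
Context {R : realType}.
Local Notation C := R[i].
Local Notation Re := (@complex.Re R).
Local Notation Im := (@complex.Im R).
Local Notation mu := (@lebesgue_measure R).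
Local Notation proj := Defs.proj.
Implicit Types (D : set R) (I : interval R) (u v w f g h : R -> C) (z a b c : C).

Lemma Re_cexp z : Re (cexp z) = expR (Re z) * cos (Im z).
Proof. by rewrite /cexp complex_partE /= mul0r subr0. Qed.

Lemma Im_cexp z : Im (cexp z) = expR (Re z) * sin (Im z).
Proof. by rewrite /cexp complex_partE /= mul0r addr0. Qed.

Lemma cexpD z a : cexp (z + a) = cexp z * cexp a.
Proof.
apply: complex_eq.
  by rewrite complex_ReM !(Re_cexp, Im_cexp) !complex_partE expRD cosD; ring.
by rewrite complex_ImM !(Re_cexp, Im_cexp) !complex_partE expRD sinD; ring.
Qed.

Lemma cexp0 : cexp (0 : C) = 1.
Proof.
by apply: complex_eq; rewrite (Re_cexp, Im_cexp) expR0 ?cos0 ?sin0 mul1r.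
Qed.

Lemma cexp_neq0 z : cexp z != 0.
Proof.
have /eqP := cexpD z (- z); rewrite subrr cexp0 eq_sym => /eqP E.
by apply/eqP => z0; move: E; rewrite z0 mul0r => /esym/eqP; rewrite oner_eq0.
Qed.

Lemma Re_cexp_line z (x : R) :
  Re (cexp (z * x%:C)) = expR (Re z * x) * cos (Im z * x).
Proof. by rewrite Re_cexp !complex_partE /= !mulr0 subr0 add0r. Qed.

Lemma Im_cexp_line z (x : R) :
  Im (cexp (z * x%:C)) = expR (Re z * x) * sin (Im z * x).
Proof. by rewrite Im_cexp !complex_partE /= !mulr0 subr0 add0r. Qed.

Lemma sqr_normc_cexp_line z (x : R) : Re (cexp (z * x%:C)) ^+ 2 +
  Im (cexp (z * x%:C)) ^+ 2 = expR (2 * Re z * x).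
Proof.
rewrite Re_cexp_line Im_cexp_line !exprMn -mulrDr cos2Dsin2 mulr1.
by rewrite expr2 -expRD; congr expR; ring.
Qed.

Lemma is_derive_mulr (s x : R) : is_derive x (1 : R) ( *%R s) s.
Proof. by apply: is_derive_eq; exact: mulr1. Qed.

Lemma is_derive_expR_line (s x : R) :
  is_derive x (1 : R) (fun t => expR (s * t)) (s * expR (s * x)).
Proof. by rewrite mulrC; exact: is_derive1_comp (is_derive_mulr s x). Qed.

Lemma is_derive_cos_line (s x : R) :
  is_derive x (1 : R) (fun t => cos (s * t)) (- s * sin (s * x)).
Proof.
by rewrite mulNr mulrC -mulNr; exact: is_derive1_comp (is_derive_mulr s x).
Qed.

Lemma is_derive_sin_line (s x : R) :
  is_derive x (1 : R) (fun t => sin (s * t)) (s * cos (s * x)).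
Proof. by rewrite mulrC; exact: is_derive1_comp (is_derive_mulr s x). Qed.

Lemma is_derive_continuous (p v : R -> R) :
  (forall x, is_derive x (1 : R) p (v x)) -> continuous p.
Proof.
by move=> dp t; apply/differentiable_continuous/derivable1_diffP; case: (dp t).
Qed.

Lemma ac_deriv_cexp D z :
  ac_deriv D (fun x => cexp (z * x%:C)) (fun x => z * cexp (z * x%:C)).
Proof.
pose p x := expR (Re z * x) * cos (Im z * x).
pose q x := expR (Re z * x) * sin (Im z * x).
have dp x : is_derive x (1 : R) p (Re z * p x - Im z * q x).
  apply: (is_derive_eq (is_deriveM
    (is_derive_expR_line (Re z) x) (is_derive_cos_line (Im z) x))).
  by rewrite /p /q /GRing.scale /=; ring.
have dq x : is_derive x (1 : R) q (Re z * q x + Im z * p x).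
  apply: (is_derive_eq (is_deriveM
    (is_derive_expR_line (Re z) x) (is_derive_sin_line (Im z) x))).
  by rewrite /p /q /GRing.scale /=; ring.
have cp := is_derive_continuous dp; have cq := is_derive_continuous dq.
have pE : Re \o (fun x => cexp (z * x%:C)) = p.
  by apply/funext => x; exact: Re_cexp_line.
have qE : Im \o (fun x => cexp (z * x%:C)) = q.
  by apply/funext => x; exact: Im_cexp_line.
apply/ac_derivP; rewrite pE qE; split.
  rewrite (_ : _ \o _ = fun x => Re z * p x - Im z * q x); last first.
    by apply/funext => x; rewrite /= complex_partE Re_cexp_line Im_cexp_line.
  apply: is_derive_real_ac_deriv dp _ => x.
  by apply: cvgB; apply: cvgMr; [exact: cp|exact: cq].
rewrite (_ : _ \o _ = fun x => Re z * q x + Im z * p x); last first.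
  by apply/funext => x; rewrite /= complex_partE Re_cexp_line Im_cexp_line.
apply: is_derive_real_ac_deriv dq _ => x.
by apply: cvgD; apply: cvgMr; [exact: cq|exact: cp].
Qed.

Lemma expR_integral_lty (s rho : R) : 0 < s ->
  (\int[mu]_(x in `[rho, +oo[) (expR (- (s * x)))%:E < +oo)%E.
Proof.
move=> s0; pose F x := - s^-1 * expR (- s * x).
have dF x : is_derive x (1 : R) F (expR (- s * x)).
  apply: (is_derive_eq (is_deriveZ (- s^-1) (is_derive_expR_line (- s) x))).
  by rewrite /GRing.scale /= mulrA mulrNN mulVf ?gt_eqF// mul1r.
have cF := is_derive_continuous dF.
have ce : continuous (fun x => expR (- s * x)).
  exact: (is_derive_continuous (is_derive_expR_line (- s))).
under eq_integral do rewrite -mulNr.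
rewrite (@ge0_continuous_FTC2y _ _ F rho 0) ?ltry//.
- exact: continuous_subspaceT.
- rewrite -[X in _ --> X](mulr0 (- s^-1)); apply: cvgMr.
  have -> : (fun x => expR (- s * x)) = (fun x => expR (- x)) \o ( *%R s).
    by apply/funext => x /=; rewrite mulNr.
  by apply: cvg_comp (@cvgr_expR R); apply: gt0_cvgMry => //; exact: cvg_id.
- by apply: cvg_at_right_filter; exact: cF.
- by move=> x _; rewrite derive1E; exact: derive_val.
Qed.

(** Building block of all the waves: cut off by zero away from its half-line, it is a function on
    the whole line with nonzero Cauchy data at one end of the gap only. *)
Definition cexp_on I z : R -> C := fun x => if x \in I then cexp (z * x%:C) else 0.

Lemma L2_cexp_on I z :
  (\int[mu]_(x in [set` I]) (expR (2 * Re z * x))%:E < +oo)%E ->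
  L2 (cexp_on I z).
Proof.
move=> iI.
have mI : measurable_fun setT (fun x : R => x \in I).
  apply: (measurable_fun_bool true); rewrite setTI.
  have -> : (fun x : R => x \in I) @^-1` [set true] = [set` I] by [].
  exact: measurable_itv.
have ce (s : R) : continuous (fun x => expR (s * x)).
  exact: (is_derive_continuous (is_derive_expR_line s)).
have cc (s : R) : continuous (fun x => cos (s * x)).
  exact: (is_derive_continuous (is_derive_cos_line s)).
have cs (s : R) : continuous (fun x => sin (s * x)).
  exact: (is_derive_continuous (is_derive_sin_line s)).
pose G x := (if x \in I then expR (2 * Re z * x) else 0)%:E.
have mG : measurable_fun setT G.
  apply/measurable_EFinP; apply: measurable_fun_ifT => //.
  exact: continuous_measurable_fun.
have iG : (\int[mu]_x G x < +oo)%E.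
  apply: le_lt_trans iI; rewrite [leRHS]integral_mkcond le_eqVlt.
  apply/orP; left; apply/eqP; apply: eq_integral => x _.
  by rewrite patchE mem_setE /G; case: ifP.
have mr : measurable_fun setT (Re \o cexp_on I z).
  rewrite (_ : _ \o _ = fun x => if x \in I then
      expR (Re z * x) * cos (Im z * x) else 0); last first.
    by apply/funext => x; rewrite /= /cexp_on; case: ifP; rewrite ?Re_cexp_line.
  apply: measurable_fun_ifT => //; apply: measurable_funM.
    exact: continuous_measurable_fun.
  exact: continuous_measurable_fun.
have mi : measurable_fun setT (Im \o cexp_on I z).
  rewrite (_ : _ \o _ = fun x => if x \in I then
      expR (Re z * x) * sin (Im z * x) else 0); last first.
    by apply/funext => x; rewrite /= /cexp_on; case: ifP; rewrite ?Im_cexp_line.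
  apply: measurable_fun_ifT => //; apply: measurable_funM.
    exact: continuous_measurable_fun.
  exact: continuous_measurable_fun.
split; apply: (@Lfun2_dominated _ _ G) => // x; rewrite lee_fin /cexp_on.
  case: ifP => _; last by rewrite /= expr0n.
  by rewrite -sqr_normc_cexp_line lerDl sqr_ge0.
case: ifP => _; last by rewrite /= expr0n.
by rewrite -sqr_normc_cexp_line lerDr sqr_ge0.
Qed.

Section half_lines.
Variable rho : R.
Hypothesis rho_gt0 : 0 < rho.

Lemma ext_itv (x : R) : ext rho x <-> x \in `[rho, +oo[ \/ x \in `]-oo, - rho].
Proof.
rewrite /ext /= !in_itv/= andbT; split=> [|[xr|xr]].
- by rewrite ler_normr => /orP[|]; [left|right; rewrite lerNr].
- by rewrite ler_normr xr.
- by rewrite ler_normr lerNr xr orbT.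
Qed.

(** A segment meeting both half-lines would contain 0, which is not in the exterior because
    [rho > 0]; so every admissible segment lies in one half-line. *)
Lemma ac_deriv_ext u v : ac_deriv `[rho, +oo[ u v -> ac_deriv `]-oo, - rho] u v ->
  ac_deriv (ext rho) u v.
Proof.
move=> uvR uvL x y xy xyE.
have [xr|xr] := leP rho x.
  apply: uvR => // t /=; rewrite !in_itv/= andbT => /andP[+ _].
  exact: le_trans.
have yr : y <= - rho.
  have /ext_itv[] : ext rho x by apply: xyE; rewrite /= in_itv/= lexx xy.
    by rewrite in_itv/= andbT leNgt xr.
  rewrite in_itv/= => xr'.
  have /ext_itv[] : ext rho y by apply: xyE; rewrite /= in_itv/= lexx xy.
    rewrite in_itv/= andbT => ry.
    have : ext rho 0.
      apply: xyE; rewrite /= in_itv/= (le_trans (ltW rho_gt0) ry) andbT.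
      by rewrite (le_trans xr')// oppr_le0 ltW.
    by rewrite /ext /= normr0 leNgt rho_gt0.
  by rewrite in_itv.
apply: uvL => // t /=; rewrite !in_itv/= => /andP[_ ty].
exact: le_trans yr.
Qed.

Lemma disjoint_half_lines (x : R) :
  x \in `[rho, +oo[ -> x \in `]-oo, - rho] -> False.
Proof.
rewrite !in_itv/= andbT => rx xr; have := le_trans rx xr.
by rewrite leNgt (lt_trans _ rho_gt0)// oppr_lt0.
Qed.

Lemma ac_deriv_cexp_on I z : I = `[rho, +oo[ \/ I = `]-oo, - rho] ->
  ac_deriv (ext rho) (cexp_on I z) (fun x => z * cexp_on I z x).
Proof.
have d0 D : ac_deriv D (fun=> 0 : C) (fun=> z * 0).
  apply/ac_derivP; rewrite mulr0.
  have r0 : real_ac_deriv D (fun=> 0 : R) (fun=> 0).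
    by apply: is_derive_real_ac_deriv => x; exact: cvg_cst.
  by split.
have dI J : ac_deriv [set` J] (cexp_on J z) (fun x => z * cexp_on J z x).
  by apply: (eq_ac_deriv _ _ (@ac_deriv_cexp [set` J] z)) => x /= xJ; rewrite /cexp_on xJ.
have dIC J J' : (forall x, x \in J -> x \in J' -> False) ->
    ac_deriv [set` J'] (cexp_on J z) (fun x => z * cexp_on J z x).
  move=> JJ'; apply: (eq_ac_deriv _ _ (d0 [set` J'])) => x /= xJ'.
    by rewrite /cexp_on; case: ifP => // /JJ' /(_ xJ').
  by rewrite /cexp_on; case: ifP => // /JJ' /(_ xJ').
by case=> ->; apply: ac_deriv_ext => //; apply: dIC => x xL xR;
  apply: (@disjoint_half_lines x).
Qed.

Lemma proj_cexp_on I z : I = `[rho, +oo[ \/ I = `]-oo, - rho] ->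
  proj rho (cexp_on I z) = cexp_on I z.
Proof.
move=> II; apply/funext => x; rewrite /proj; case: ifPn => // /negP xr.
rewrite /cexp_on; case: ifP => // xI; exfalso; apply/xr/ext_itv.
by case: II xI => -> ?; [left|right].
Qed.

Lemma W22_cexp_on I z : I = `[rho, +oo[ \/ I = `]-oo, - rho] ->
  L2 (cexp_on I z) ->
  W22 rho (cexp_on I z) (fun x => z * cexp_on I z x)
    (fun x => z * (z * cexp_on I z x)).
Proof.
move=> II I2; have L2z (c : C) : L2 (proj rho (fun x => c * cexp_on I z x)).
  by apply: L2_proj; exact: L2_scale.
split.
- exact: L2_proj.
- exact: L2z.
- rewrite (_ : (fun x => _) = (fun x => (z * z) * cexp_on I z x))//.
  by apply/funext => x; rewrite mulrA.
- exact: ac_deriv_cexp_on.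
(* [ac_deriv_lin] always adds a second function, so [z e] is obtained as [- e + (z e + e)]. *)
- have := ac_deriv_lin z (ac_deriv_cexp_on z II) (ac_deriv_cexp_on z II).
  move=> /(ac_deriv_lin (-1) (ac_deriv_cexp_on z II)).
  by apply: eq_ac_deriv => x _; ring.
Qed.

Lemma L2_cexp_right z : Re z < 0 -> L2 (cexp_on `[rho, +oo[ z).
Proof.
move=> z0; apply: L2_cexp_on.
have /expR_integral_lty : 0 < - (2 * Re z) by lra.
move=> /(_ rho); apply: le_lt_trans; rewrite le_eqVlt; apply/orP; left; apply/eqP.
by apply: eq_integral => x _; rewrite mulNr opprK.
Qed.

Lemma L2_cexp_left z : 0 < Re z -> L2 (cexp_on `]-oo, - rho] z).
Proof.
move=> z0; apply: L2_cexp_on.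
have /expR_integral_lty : 0 < 2 * Re z by lra.
move=> /(_ rho); apply: le_lt_trans.
have ce : continuous (fun x => expR (2 * Re z * x)).
  exact: (is_derive_continuous (is_derive_expR_line (2 * Re z))).
rewrite (@ge0_integration_by_substitutionNy _ (fun x => expR (2 * Re z * x)))//.
  rewrite le_eqVlt; apply/orP; left; apply/eqP.
  by apply: eq_integral => x _; rewrite /= mulrN.
exact: continuous_subspaceT.
Qed.

(** A half-line has infinite measure, so a positive lower bound on [|f|^2] there makes its integral
    infinite. *)
Lemma L2_not_bounded_below I f (e : R) : I = `[rho, +oo[ \/ I = `]-oo, - rho] ->
  L2 f -> 0 < e ->
  (forall x, x \in I -> e <= Re (f x) ^+ 2 + Im (f x) ^+ 2) -> False.
Proof.
move=> II [/Lfun2P[mr ir] /Lfun2P[mi ii]] e0 ef.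
have muI : mu [set` I] = +oo%E.
  by case: II => ->; rewrite lebesgue_measure_itv /= ?ltry ?ltNyr.
have : (\int[mu]_(x in [set` I]) e%:E <=
        \int[mu]_x ((Re (f x) ^+ 2)%:E + (Im (f x) ^+ 2)%:E))%E.
  rewrite integral_mkcond; apply: ge0_le_integral => //.
  - by move=> x _; apply: erestrict_ge0 => t _; rewrite lee_fin ltW.
  - apply/(measurable_restrictT _ _).1 => //.
  - by apply: emeasurable_funD; apply/measurable_EFinP; exact: measurable_funX.
  - move=> x _; rewrite patchE mem_setE; case: ifPn => xI.
      by rewrite -EFinD lee_fin ef.
    by rewrite -EFinD lee_fin addr_ge0// sqr_ge0.
rewrite integral_cst// [X in (_ * X)%E]muI gt0_muley ?lte_fin//.
rewrite ge0_integralD//; last 4 first.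
- by move=> x _; rewrite lee_fin sqr_ge0.
- by apply/measurable_EFinP; exact: measurable_funX.
- by move=> x _; rewrite lee_fin sqr_ge0.
- by apply/measurable_EFinP; exact: measurable_funX.
by rewrite leye_eq => /eqP E; have := lte_add_pinfty ir ii; rewrite E ltxx.
Qed.

End half_lines.
End exponentials.

(** * The homogeneous equation on a half-line *)

Section differential_equation.
Context {R : realType}.
Local Notation C := R[i].
Local Notation Re := (@complex.Re R).
Local Notation Im := (@complex.Im R).
Local Notation mu := (@lebesgue_measure R).
Local Notation proj := Defs.proj.
Implicit Types (D : set R) (I : interval R) (u v w f g h : R -> C) (z a b c : C).

Lemma real_ac_deriv_ae_eq0 (p v w : R -> R) (a b : R) : a < b ->
  real_ac_deriv `[a, b] p v -> real_ac_deriv `[a, b] v w ->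
  {ae mu, forall x, x \in `[a, b] -> p x = 0} ->
  forall x, x \in `[a, b] -> p x = 0 /\ v x = 0.
Proof.
move=> ab pv vw p0.
have cp := real_ac_deriv_continuous (ltW ab) pv.
have cv := real_ac_deriv_continuous (ltW ab) vw.
have {}p0 := continuous_ae_eq0 ab cp p0.
by move=> x xab; split; [exact: p0|exact: (real_ac_deriv_cst ab pv cv p0)].
Qed.

Lemma ac_deriv_ae_eq0 u v w (a b : R) : a < b ->
  ac_deriv `[a, b] u v -> ac_deriv `[a, b] v w ->
  {ae mu, forall x, x \in `[a, b] -> u x = 0} ->
  forall x, x \in `[a, b] -> u x = 0 /\ v x = 0.
Proof.
move=> ab /ac_derivP[ur ui] /ac_derivP[vr vi] u0 x xab.
have ur0 : {ae mu, forall x, x \in `[a, b] -> (Re \o u) x = 0}.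
  by apply: ae_filterS u0 => t /= ut tab; rewrite ut.
have ui0 : {ae mu, forall x, x \in `[a, b] -> (Im \o u) x = 0}.
  by apply: ae_filterS u0 => t /= ut tab; rewrite ut.
have [? ?] := real_ac_deriv_ae_eq0 ab ur vr ur0 xab.
have [? ?] := real_ac_deriv_ae_eq0 ab ui vi ui0 xab.
by split; apply: complex_eq.
Qed.

(** For [f = p + i q] the system is [f' = (r + i s) f]. The quantity [|f|^2 exp (- 2 r t)] has zero
    derivative, hence is constant, and it vanishes at [x]. *)
Lemma real_ode_eq0 (p q : R -> R) (r s a b x y : R) :
  real_ac_deriv `[a, b] p (fun t => r * p t - s * q t) ->
  real_ac_deriv `[a, b] q (fun t => r * q t + s * p t) ->
  x \in `[a, b] -> y \in `[a, b] -> p x = 0 -> q x = 0 -> p y = 0 /\ q y = 0.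
Proof.
move=> dp dq xab yab px qx; have ab : a <= b.
  by move: xab; rewrite in_itv/= => /andP[]; exact: le_trans.
have cp := real_ac_deriv_continuous ab dp.
have cq := real_ac_deriv_continuous ab dq.
have cp' : {within `[a, b], continuous (fun t => r * p t - s * q t)}.
  by move=> t; apply: cvgB; apply: cvgMr; [exact: cp|exact: cq].
have cq' : {within `[a, b], continuous (fun t => r * q t + s * p t)}.
  by move=> t; apply: cvgD; apply: cvgMr; [exact: cq|exact: cp].
pose n t := (p t * p t + q t * q t) * expR (- (2 * r) * t).
have cn : {within `[a, b], continuous n}.
  move=> t; apply: cvgM.
    by apply: cvgD; apply: cvgM; [exact: cp|exact: cp|exact: cq|exact: cq].
  apply: (@continuous_subspaceT _ _ _ (fun t => expR (- (2 * r) * t))).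
  exact: (is_derive_continuous (is_derive_expR_line (- (2 * r)))).
have dn t : t \in `]a, b[ -> is_derive t 1 n 0.
  move=> tab; have dpt := real_ac_deriv_is_derive dp cp' tab.
  have dqt := real_ac_deriv_is_derive dq cq' tab.
  apply: (is_derive_eq (is_deriveM
    (is_deriveD (is_deriveM dpt dpt) (is_deriveM dqt dqt))
    (is_derive_expR_line (- (2 * r)) t))).
  rewrite /GRing.scale /=.
  change ((p t * p t + q t * q t) * (- (2 * r) * expR (- (2 * r) * t)) +
    expR (- (2 * r) * t) * (p t * (r * p t - s * q t) + p t * (r * p t - s * q t) +
    (q t * (r * q t + s * p t) + q t * (r * q t + s * p t))) = 0).
  by ring.
have nE x' y' : x' \in `[a, b] -> y' \in `[a, b] -> x' <= y' -> n x' = n y'.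
  move=> xab' yab' xy; have sub := subset_itvcc xab' yab'.
  have dn' t : t \in `]x', y'[ -> is_derive t 1 n (cst 0 t).
    move=> txy; apply: dn; move: txy xab' yab'; rewrite !in_itv/=.
    move=> /andP[xt ty] /andP[ax _] /andP[_ yb].
    by rewrite (le_lt_trans ax xt) (lt_le_trans ty yb).
  have [c _] := MVT_segment xy dn' (continuous_subspaceW sub cn).
  by rewrite mul0r => /eqP; rewrite subr_eq0 => /eqP.
have : n y = 0.
  have nx : n x = 0 by rewrite /n px qx mul0r addr0 mul0r.
  by have [xy|/ltW yx] := leP x y; [rewrite -(nE x y)|rewrite (nE y x)].
move=> /eqP; rewrite mulf_eq0 (gt_eqF (expR_gt0 _)) orbF -!expr2.
by rewrite paddr_eq0 ?sqr_ge0// !sqrf_eq0 => /andP[/eqP-> /eqP->].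
Qed.

(** Subtracting the exponential with the same value at [x] leaves a solution of the same equation
    that vanishes at [x], hence everywhere by [real_ode_eq0]. *)
Lemma ode_exp z v (a b x y : R) : ac_deriv `[a, b] v (fun t => z * v t) ->
  x \in `[a, b] -> y \in `[a, b] -> v y = v x * cexp (z * (y - x)%:C).
Proof.
move=> dv xab yab.
pose c := v x * cexp (- (z * x%:C)).
pose w t := v t - c * cexp (z * t%:C).
have dw : ac_deriv `[a, b] w (fun t => z * w t).
  have := ac_deriv_lin (- c) (@ac_deriv_cexp _ `[a, b] z) dv.
  by apply: eq_ac_deriv => t _; rewrite /w; ring.
have zE t : cexp (z * (t - x)%:C) = cexp (- (z * x%:C)) * cexp (z * t%:C).
  by rewrite -cexpD; congr cexp; rewrite rmorphB /=; ring.
have wx : w x = 0.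
  rewrite /w /c -mulrA -zE subrr.
  by rewrite (_ : z * 0%:C = 0) ?cexp0 ?mulr1 ?subrr// mulr0.
have [dr di] := (ac_derivP _ _ _).1 dw.
have dr' : real_ac_deriv `[a, b] (Re \o w)
    (fun t => Re z * (Re \o w) t - Im z * (Im \o w) t).
  by move: dr; congr real_ac_deriv; apply/funext => t /=; rewrite complex_ReM.
have di' : real_ac_deriv `[a, b] (Im \o w)
    (fun t => Re z * (Im \o w) t + Im z * (Re \o w) t).
  by move: di; congr real_ac_deriv; apply/funext => t /=; rewrite complex_ImM.
have [||wr wi] := real_ode_eq0 dr' di' xab yab.
- by rewrite /= wx.
- by rewrite /= wx.
have : w y = 0 by apply: complex_eq.
by rewrite /w /c -mulrA -zE => /eqP; rewrite subr_eq0 => /eqP.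
Qed.

Section exterior.
Variable rho : R.
Hypothesis rho_gt0 : 0 < rho.

(** Pairs each half-line with its end point, so that the two sides of the gap are handled by a
    single argument. *)
Definition half_line I (x0 : R) :=
  (I = `[rho, +oo[ /\ x0 = rho) \/ (I = `]-oo, - rho] /\ x0 = - rho).

Lemma half_lineE I x0 : half_line I x0 -> I = `[rho, +oo[ \/ I = `]-oo, - rho].
Proof. by case=> -[-> _]; [left|right]. Qed.

Lemma half_line_ext I x0 : half_line I x0 -> [set` I] `<=` ext rho.
Proof. by case=> -[-> _] x /= xI; apply/ext_itv; [left|right]. Qed.

Lemma half_line_segment I x0 (x : R) : half_line I x0 -> x \in I ->
  exists a b : R, [/\ a < b, x0 \in `[a, b], x \in `[a, b] & `[a, b] `<=` [set` I]].
Proof.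
case=> -[-> ->].
  (* One unit is added beyond [x] because [x] may be the end point itself and the segment must not
     degenerate. *)
  rewrite in_itv/= andbT => rx; exists rho, (x + 1).
  have rx1 : rho < x + 1 by rewrite (le_lt_trans rx)// ltrDl.
  split => //; rewrite ?in_itv/= ?lexx ?rx ?(ltW rx1)// ?lerDl ?ler01//.
  by move=> t /=; rewrite !in_itv/= andbT => /andP[].
rewrite in_itv/= => xr; exists (x - 1), (- rho).
have rx1 : x - 1 < - rho by rewrite (lt_le_trans _ xr)// gtrBl.
split => //; rewrite ?in_itv/= ?lexx ?xr ?(ltW rx1)// ?gerBl ?ler01//.
by move=> t /=; rewrite !in_itv/= => /andP[].
Qed.

Lemma W22_ae_eq0 u u1 u2 : W22 rho u u1 u2 -> proj rho u = (fun=> 0) %[ae mu] ->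
  forall x, ext rho x -> u x = 0 /\ u1 x = 0.
Proof.
move=> [_ _ _ du du1] /aeP u0 x /ext_itv.
have : exists I x0, half_line I x0 /\
    (x \in `[rho, +oo[ \/ x \in `]-oo, - rho] -> x \in I).
  have [xr|xr] := boolP (x \in `[rho, +oo[).
    by exists `[rho, +oo[, rho; split; first by left.
  exists `]-oo, - rho], (- rho); split; first by right.
  by case=> // /negP; rewrite (negbTE xr).
move=> [I [x0 [II xI]]] /xI {}xI.
have [a [b [ab _ xab abI]]] := half_line_segment II xI.
have sub := subset_trans abI (half_line_ext II).
apply: (ac_deriv_ae_eq0 ab (ac_derivS sub du) (ac_derivS sub du1) _ xab).
by apply: ae_filterS u0 => t + tab; rewrite projE//; exact: sub.
Qed.

(** This makes the boundary values of a class modulo null sets well defined: the difference of two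
    representatives is continuous and vanishes almost everywhere, hence vanishes with its derivative
    up to the end points. *)
Lemma W22_unique u u1 u2 v v1 v2 : W22 rho u u1 u2 -> W22 rho v v1 v2 ->
  proj rho u = proj rho v %[ae mu] ->
  forall x, ext rho x -> u x = v x /\ u1 x = v1 x.
Proof.
move=> Wu Wv /aeP uv x xe.
have Wvu := W22_lin (-1) Wu Wv.
have : proj rho (fun x => -1 * u x + v x) = (fun=> 0) %[ae mu].
  by apply/aeP; apply: ae_filterS uv => t uvt; rewrite proj_lin uvt mulN1r addNr.
move=> /(W22_ae_eq0 Wvu) /(_ _ xe)[].
by rewrite !mulN1r => /eqP + /eqP; rewrite !addr_eq0 !eqr_opp => /eqP-> /eqP->.
Qed.

(* [w1 - z * w] solves [v' = - z v], whose nonzero solutions grow along the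
   half-line and hence are not square-integrable. *)
Lemma W22_homogeneous I x0 z w w1 w2 : half_line I x0 ->
  (forall x, x \in I -> Re z * (x - x0) <= 0) ->
  W22 rho w w1 w2 -> (forall x, ext rho x -> w2 x = z ^+ 2 * w x) ->
  exists c, forall x, x \in I -> w x = c * cexp (z * x%:C).
Proof.
move=> II zx [w_2 w1_2 _ dw dw1] w2E; have sub := half_line_ext II.
pose v x := - z * w x + w1 x.
have dv : ac_deriv (ext rho) v (fun x => - z * v x).
  have := ac_deriv_lin (- z) dw dw1; apply: eq_ac_deriv => x // xe.
  by rewrite w2E// /v; ring.
have vE x : x \in I -> v x = v x0 * cexp (- z * (x - x0)%:C).
  move=> xI; have [a [b [ab x0ab xab abI]]] := half_line_segment II xI.
  have subab := subset_trans abI sub.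
  exact: ode_exp (ac_derivS subab dv) x0ab xab.
have v2 : L2 (proj rho v) by rewrite proj_lin; exact: L2_lin.
have v0 : v x0 = 0.
  apply/eqP; apply: contrapT => /negP v0.
  apply: (@L2_not_bounded_below _ rho I _ (Re (v x0) ^+ 2 + Im (v x0) ^+ 2)
    (half_lineE II) v2).
    rewrite lt_def addr_ge0 ?sqr_ge0// andbT paddr_eq0 ?sqr_ge0// !sqrf_eq0.
    by apply: contra v0 => /andP[/eqP r0 /eqP i0]; apply/eqP/complex_eq.
  move=> x xI; rewrite projE; last exact: sub.
  rewrite (vE x xI) (complex_ReM (v x0)) (complex_ImM (v x0)).
  set p := Re (v x0); set q := Im (v x0).
  have := sqr_normc_cexp_line (- z) (x - x0).
  set r := Re (cexp _); set s := Im (cexp _) => rs.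
  have rs1 : 1 <= r ^+ 2 + s ^+ 2.
    rewrite rs -[leLHS]expR0 ler_expR complex_ReN.
    rewrite (_ : 2 * - Re z * (x - x0) = - (2 * (Re z * (x - x0)))); last by ring.
    by rewrite oppr_ge0 pmulr_rle0// zx.
   rewrite (_ : _ + (_ + _) ^+ 2 = (p ^+ 2 + q ^+ 2) * (r ^+ 2 + s ^+ 2)); last by ring.
  by rewrite ler_peMr// addr_ge0// sqr_ge0.
have w1E x : x \in I -> w1 x = z * w x.
  move=> xI; have := vE x xI; rewrite v0 mul0r /v mulNr addrC => /eqP.
  by rewrite subr_eq0 => /eqP.
exists (w x0 * cexp (- (z * x0%:C))) => x xI.
have [a [b [ab x0ab xab abI]]] := half_line_segment II xI.
have subab := subset_trans abI sub.
have dwI : ac_deriv `[a, b] w (fun t => z * w t).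
  apply: (eq_ac_deriv _ _ (ac_derivS subab dw)) => t // /abI; exact: w1E.
rewrite (ode_exp dwI x0ab xab) -mulrA -cexpD; congr (_ * cexp _).
by rewrite rmorphB /=; ring.
Qed.

End exterior.
End differential_equation.

(** * Resolvents of Schroedinger operators *)

Section resolvents.
Context {R : realType}.
Local Notation C := R[i].
Local Notation Re := (@complex.Re R).
Local Notation Im := (@complex.Im R).
Local Notation "z ^*" := (conjc z) : ring_scope.
Local Notation mu := (@lebesgue_measure R).
Local Notation proj := Defs.proj.
Implicit Types (D : set R) (u v w f g h : R -> C) (z a b c : C).

Lemma real_ac_derivT_continuous (p v : R -> R) :
  real_ac_deriv setT p v -> continuous p.
Proof.
move=> pv x; have xx : x - 1 < x + 1 by lra.
have := real_ac_deriv_continuous (ltW xx) (real_ac_derivS (@subsetT _ _) pv).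
move=> /(continuous_within_itvP _ xx)[+ _ _]; apply.
by rewrite in_itv/= gtrBl ltrDl ltr01.
Qed.

Lemma ac_derivT_cmeasurable u v : ac_deriv setT u v -> cmeasurable u.
Proof.
by move=> /ac_derivP[ur ui]; split; apply: continuous_measurable_fun;
  [exact: real_ac_derivT_continuous ur|exact: real_ac_derivT_continuous ui].
Qed.

(** From any exterior point, the segment of length 2 pointing away from the gap stays in the
    exterior, which is the geometric condition of [Lfun2_derivative]. *)
Lemma L2_proj_derivative (rho : R) u v w : 0 < rho ->
  ac_deriv (ext rho) u v -> ac_deriv (ext rho) v w -> cmeasurable v ->
  L2 (proj rho u) -> L2 (proj rho w) -> L2 (proj rho v).
Proof.
move=> rho0 /ac_derivP[ur ui] /ac_derivP[vr vi] [mr mi].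
have mE := @measurable_ext R rho.
have sE (x : R) : ext rho x -> `[x, x + 2] `<=` ext rho \/ `[x - 2, x] `<=` ext rho.
  case/ext_itv; rewrite in_itv/= ?andbT => xr; [left|right] => t /=;
    rewrite in_itv/= => /andP[xt tx]; apply/ext_itv; rewrite !in_itv/= andbT.
    by left; exact: le_trans xt.
  by right; exact: le_trans xr.
have reE f : (fun x => Re (proj rho f x)) = (Re \o f) \_ (ext rho).
  exact: Re_proj.
have imE f : (fun x => Im (proj rho f x)) = (Im \o f) \_ (ext rho).
  exact: Im_proj.
rewrite /L2 !reE !imE => -[ur2 ui2] [wr2 wi2]; split.
  by apply: Lfun2_derivative ur vr _ ur2 wr2 => //; exact: measurable_funTS.
by apply: Lfun2_derivative ui vi _ ui2 wi2 => //; exact: measurable_funTS.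
Qed.

Section operator.
Variables (rho : R) (q : R -> C) (H : L2operator R).
Hypothesis rho_gt0 : 0 < rho.
Hypothesis q_ext : forall x, ext rho x -> q x = 0.
Hypothesis H_q : acts_as_schrodinger q H.

(* On the exterior region the potential vanishes, so that [u'' = - (h + z u)]. *)
Lemma resolvent_W22 z h g : L2 h -> resolvent H z h g -> exists u u1,
  W22 rho u u1 (fun x => - (h x + z * u x)) /\ proj rho g = proj rho u %[ae mu].
Proof.
move=> h2 Hg; have [g2 _] := op_L2 Hg.
have [u [u1 [u2 [du du1 gu Gu]]]] := H_q Hg.
have mu_ := ac_derivT_cmeasurable du; have mu1 := ac_derivT_cmeasurable du1.
have u_2 := L2_ae g2 mu_ gu.
have w2 : L2 (fun x => - (h x + z * u x)).
  have := L2_lin (- 1) h2 (L2_scale (- z) u_2).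
  by congr L2; apply/funext => x; ring.
have due := ac_derivS (@subsetT _ (ext rho)) du.
have du1e : ac_deriv (ext rho) u1 (fun x => - (h x + z * u x)).
  apply: (ac_deriv_ae (L2_measurable w2) _ (ac_derivS (@subsetT _ (ext rho)) du1)).
  move/aeP: gu => gu; move/aeP: Gu => Gu; apply: ae_filterS2 gu Gu => x -> + xe.
  by rewrite q_ext// mul0r addr0 => ->; rewrite opprK.
exists u, u1; split; last first.
  by apply/aeP; move/aeP: gu; apply: ae_filterS => x; rewrite /proj => ->.
have pu2 := L2_proj rho u_2; have pw2 := L2_proj rho w2.
by split => //; exact: L2_proj_derivative due du1e _ pu2 pw2.
Qed.

Lemma L2_norm2_eq0 f : L2 f -> norm2 f <= 0 -> f = (fun=> 0) %[ae mu].
Proof.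
move=> [fr fi]; rewrite /norm2 => nf0.
have [mr ir] := (Lfun2P _).1 fr; have [mi ii] := (Lfun2P _).1 fi.
have mr2 : measurable_fun setT (fun x => (Re (f x) ^+ 2)%:E).
  by apply/measurable_EFinP; exact: measurable_funX.
have mi2 : measurable_fun setT (fun x => (Im (f x) ^+ 2)%:E).
  by apply/measurable_EFinP; exact: measurable_funX.
have r0 x : (0 <= (Re (f x) ^+ 2)%:E)%E by rewrite lee_fin sqr_ge0.
have i0 x : (0 <= (Im (f x) ^+ 2)%:E)%E by rewrite lee_fin sqr_ge0.
have dotE : Re (dot2 f f) =
    fine (\int[mu]_x ((Re (f x) ^+ 2)%:E + (Im (f x) ^+ 2)%:E))%E.
  congr fine; apply: eq_integral => x _; rewrite -EFinD; congr (_%:E).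
  by case: (f x) => a b /=; ring.
have S0 : (0 <= \int[mu]_x ((Re (f x) ^+ 2)%:E + (Im (f x) ^+ 2)%:E))%E.
  by apply: integral_ge0 => x _; exact: adde_ge0.
(* [fine] sends infinity to 0, so finiteness must be known before a vanishing [norm2] carries any
   information. *)
have Sfin : (\int[mu]_x ((Re (f x) ^+ 2)%:E + (Im (f x) ^+ 2)%:E) < +oo)%E.
  by rewrite ge0_integralD// lte_add_pinfty.
have {}nf0 : Num.sqrt (Re (dot2 f f)) == 0.
  by rewrite eq_le sqrtr_ge0 andbT.
move: nf0; rewrite sqrtr_eq0 dotE -lee_fin fineK ?ge0_fin_numE// => S_le0.
have SE : (\int[mu]_x `|(Re (f x) ^+ 2)%:E + (Im (f x) ^+ 2)%:E| = 0)%E.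
  apply/eqP; rewrite eq_le integral_ge0// andbT; apply: le_trans S_le0.
  rewrite le_eqVlt; apply/orP; left; apply/eqP; apply: eq_integral => x _.
  by rewrite gee0_abs// adde_ge0.
have mS : measurable_fun setT
    (fun x => (Re (f x) ^+ 2)%:E + (Im (f x) ^+ 2)%:E)%E.
  exact: emeasurable_funD.
have := (ae_eq_integral_abs mu measurableT mS).1 SE.
move=> S_ae; apply/aeP; move: S_ae; apply: ae_filterS => x /(_ I) /= [] /eqP.
rewrite paddr_eq0 ?sqr_ge0// !sqrf_eq0 => /andP[/eqP r /eqP i].
exact: complex_eq.
Qed.

Lemma norm2_ae_eq0 f : f = (fun=> 0) %[ae mu] -> cmeasurable f -> norm2 f = 0.
Proof.
move=> /aeP f0 [mr mi]; rewrite /norm2 (_ : Re (dot2 f f) = 0) ?sqrtr0//=.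
rewrite /Rintegral (ae_eq_integral (cst 0%E))//= ?integral0//.
  apply/measurable_EFinP.
  rewrite (_ : (fun x => _) = fun x => Re (f x) * Re (f x) + Im (f x) * Im (f x)).
    by apply: measurable_funD; exact: measurable_funM.
  by apply/funext => x; case: (f x) => a b /=; ring.
by apply: ae_filterS f0 => x /= -> _; rewrite mul0r.
Qed.

(** The bound contained in [resolvent_set] is applied to [g - g'], whose image under [H - z] is
    [h - h'], of norm 0. *)
Lemma resolvent_unique z h h' g g' : resolvent_set H z ->
  resolvent H z h g -> resolvent H z h' g' -> h = h' %[ae mu] ->
  g = g' %[ae mu].
Proof.
move=> [_ [M HM]] Hg Hg' /aeP hh'.
have Hd := op_linear (-1) Hg' Hg; have [d2 Gd2] := op_L2 Hd.
set d := (fun x => -1 * g' x + g x) in Hd d2.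
set G := (fun x => -1 * (h' x + z * g' x) + (h x + z * g x)) in Hd Gd2.
have r2 : L2 (fun x => G x - z * d x).
  have := L2_lin (- z) d2 Gd2; congr L2; apply/funext => x; ring.
have d0 : d = (fun=> 0) %[ae mu].
  apply: L2_norm2_eq0 => //.
  have E : norm2 (fun x => G x - z * d x) = 0.
    apply: norm2_ae_eq0 (L2_measurable r2).
    by apply/aeP; apply: ae_filterS hh' => x hx; rewrite /G /d hx; ring.
  by have := HM _ _ Hd; rewrite E mulr0.
apply/aeP; move/aeP: d0; apply: ae_filterS => x.
by rewrite /d mulN1r addrC => /eqP; rewrite subr_eq0 => /eqP.
Qed.

Lemma resolvent_exists z h : resolvent_set H z -> L2 h ->
  exists g, resolvent H z h g.
Proof.
move=> [Hz _] h2; have [f [g [Hfg /aeP E]]] := Hz h h2.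
have [f2 g2] := op_L2 Hfg; exists f.
apply: (op_ae f2 _ _ _ Hfg) => //.
  by have := L2_lin z f2 h2; congr L2; apply/funext => x; rewrite addrC.
  by apply/aeP; apply: ae_filterS E.
by apply/aeP; apply: ae_filterS E => x /= Ex; rewrite -Ex subrK.
Qed.

End operator.
End resolvents.

(** * Boundary values of D(H_k) and the S-matrix *)

Section scattering.
Context {R : realType}.
Local Notation C := R[i].
Local Notation Re := (@complex.Re R).
Local Notation Im := (@complex.Im R).
Local Notation "''i'" := ('i%C : C) : ring_scope.
Local Notation "z ^*" := (conjc z) : ring_scope.
Local Notation mu := (@lebesgue_measure R).
Local Notation proj := Defs.proj.
Variables (rho : R) (q : R -> C) (H : L2operator R) (k : C).
Hypothesis rho_gt0 : 0 < rho.
Hypothesis q_ext : forall x, ext rho x -> q x = 0.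
Hypothesis H_q : acts_as_schrodinger q H.
Hypothesis H_rho : rho_perturbed rho H.
Hypothesis k_Lambda : LambdaP H k.
Implicit Types (u v w f g h : R -> C).

(** [lam] is the exponent of the outgoing wave at [+oo] and [kap] that of the incoming one. Both
    have real part [- Im k], so they decay at [+oo] and their opposites at [-oo]; they differ by
    [2 i Re k]. *)
Local Notation lam := ('i * k).
Local Notation kap := (- ('i * k^*)).
Local Notation eR := (cexp_on `[rho, +oo[).
Local Notation eL := (cexp_on `]-oo, - rho]).

Let Im_k : 0 < Im k. Proof. by case: k_Lambda. Qed.
Let Re_k : Re k != 0. Proof. by case: k_Lambda. Qed.
Let res_k : resolvent_set H (k ^+ 2). Proof. by case: k_Lambda. Qed.

Let Re_lam : Re lam = - Im k.
Proof. by rewrite complex_ReM /= mul0r mul1r sub0r. Qed.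

Let Re_kap : Re kap = - Im k.
Proof. by case: k => a b /=; ring. Qed.

Let kap_lam : kap - lam != 0.
Proof.
apply/eqP => /(congr1 Im); case: k Re_k => a b /= a0 /eqP.
rewrite (_ : _ - _ = - (a *+ 2)); last by ring.
by rewrite oppr_eq0 mulrn_eq0 /= (negbTE a0).
Qed.

Let sqr_i_mul (c : C) : ('i * c) ^+ 2 = - c ^+ 2.
Proof. by rewrite exprMn sqr_i mulN1r. Qed.

Let L2_eR_lam : L2 (eR lam).
Proof. by apply: L2_cexp_right => //; rewrite Re_lam oppr_lt0. Qed.

Let L2_eR_kap : L2 (eR kap).
Proof. by apply: L2_cexp_right => //; rewrite Re_kap oppr_lt0. Qed.

Let L2_eL_lam : L2 (eL (- lam)).
Proof. by apply: L2_cexp_left => //; rewrite complex_ReN Re_lam opprK. Qed.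

Let L2_eL_kap : L2 (eL (- kap)).
Proof. by apply: L2_cexp_left => //; rewrite complex_ReN Re_kap opprK. Qed.

Let W_eR_lam := W22_cexp_on rho_gt0 (or_introl erefl) L2_eR_lam.
Let W_eR_kap := W22_cexp_on rho_gt0 (or_introl erefl) L2_eR_kap.
Let W_eL_lam := W22_cexp_on rho_gt0 (or_intror erefl) L2_eL_lam.
Let W_eL_kap := W22_cexp_on rho_gt0 (or_intror erefl) L2_eL_kap.

Let h1E : h1 rho k = fun x => (k^* ^+ 2 - k ^+ 2) * eR kap x.
Proof.
apply/funext => x; rewrite /h1 /cexp_on in_itv/= andbT.
by case: ifP => _; rewrite ?mulr0// mulNr.
Qed.

Let h2E : h2 rho k = fun x => (k^* ^+ 2 - k ^+ 2) * eL (- kap) x.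
Proof.
apply/funext => x; rewrite /h2 /cexp_on in_itv/=.
by case: ifP => _; rewrite ?mulr0// opprK.
Qed.

Let L2ext_h1 : L2ext rho (h1 rho k).
Proof.
rewrite h1E; split; first exact: L2_scale.
apply/aeP; apply: aeW => x.
have := congr1 (fun F => F x) (@proj_cexp_on _ rho `[rho, +oo[ kap (or_introl erefl)).
by rewrite /proj /=; case: ifP => // _ <-; rewrite mulr0.
Qed.

Let L2ext_h2 : L2ext rho (h2 rho k).
Proof.
rewrite h2E; split; first exact: L2_scale.
apply/aeP; apply: aeW => x.
have := congr1 (fun F => F x)
  (@proj_cexp_on _ rho `]-oo, - rho] (- kap) (or_intror erefl)).
by rewrite /proj /=; case: ifP => // _ <-; rewrite mulr0.
Qed.

(** Square-integrability leaves only the decaying exponential on each half-line; the equation does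
    not link the two sides of the gap, hence two free constants. *)
Lemma W22_homogeneous_ext w w1 w2 : W22 rho w w1 w2 ->
  (forall x, ext rho x -> w2 x = - k ^+ 2 * w x) ->
  exists a b, forall x, ext rho x -> w x = a * eR lam x + b * eL (- lam) x.
Proof.
move=> Ww w2E.
have Rhl : half_line rho `[rho, +oo[ rho by left.
have Lhl : half_line rho `]-oo, - rho] (- rho) by right.
have [|x /w2E|a aE] := W22_homogeneous Rhl (z := lam) _ Ww.
- move=> x; rewrite in_itv/= andbT Re_lam => rx.
  by rewrite mulNr oppr_le0 mulr_ge0 ?subr_ge0// ltW.
- by rewrite sqr_i_mul.
have [|x /w2E|b bE] := W22_homogeneous Lhl (z := - lam) _ Ww.
- move=> x; rewrite in_itv/= complex_ReN Re_lam opprK => rx.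
  by rewrite pmulr_rle0// subr_le0.
- by rewrite sqrrN sqr_i_mul.
exists a, b => x /ext_itv[] xI; rewrite /cexp_on xI.
  rewrite ifF ?mulr0 ?addr0 ?aE//; apply/negP.
  exact: disjoint_half_lines xI.
rewrite ifF ?mulr0 ?add0r ?bE//; apply/negP => xR.
exact: disjoint_half_lines xR xI.
Qed.

(* Up to [proj rho], the forms [f1_form] and [f2_form]; the pair of coefficients
   is (reflection, transmission). *)
Definition right_wave (c : C * C) (x : R) := c.1 * eR lam x + (c.2 * eL (- lam) x + eR kap x).
Definition right_wave_deriv (c : C * C) (x : R) := c.1 * (lam * eR lam x) +
  (c.2 * (- lam * eL (- lam) x) + kap * eR kap x).
Definition left_wave (c : C * C) (x : R) := c.2 * eR lam x + (c.1 * eL (- lam) x + eL (- kap) x).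
Definition left_wave_deriv (c : C * C) (x : R) := c.2 * (lam * eR lam x) +
  (c.1 * (- lam * eL (- lam) x) + - kap * eL (- kap) x).

Lemma W22_right_wave c : exists d2r, W22 rho (right_wave c) (right_wave_deriv c) d2r.
Proof.
have W := W22_lin c.1 W_eR_lam (W22_lin c.2 W_eL_lam W_eR_kap).
by eexists; exact: W.
Qed.

Lemma W22_left_wave c : exists d2l, W22 rho (left_wave c) (left_wave_deriv c) d2l.
Proof.
have W := W22_lin c.2 W_eR_lam (W22_lin c.1 W_eL_lam W_eL_kap).
by eexists; exact: W.
Qed.

Lemma f1_formE c : f1_form rho k c = proj rho (right_wave c).
Proof.
apply/funext => x; rewrite /f1_form /proj; case: ifPn => // xe.
have /ext_itv : ext rho x by [].
rewrite /right_wave /cexp_on !in_itv/= andbT; case: ifPn => rx xI.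
  have -> : (x <= - rho) = false.
    apply/negP => xr; apply: (@disjoint_half_lines _ rho rho_gt0 x);
    by rewrite in_itv/= ?rx.
  by rewrite mulr0 add0r mulNr addrC.
have -> : x <= - rho by case: xI => //; rewrite (negbTE rx).
by rewrite mulr0 add0r addr0 mulNr.
Qed.

Lemma f2_formE c : f2_form rho k c = proj rho (left_wave c).
Proof.
apply/funext => x; rewrite /f2_form /proj; case: ifPn => // xe.
have /ext_itv : ext rho x by [].
rewrite /left_wave /cexp_on !in_itv/= andbT; case: ifPn => rx xI.
  have -> : (x <= - rho) = false.
    apply/negP => xr; apply: (@disjoint_half_lines _ rho rho_gt0 x);
    by rewrite in_itv/= ?rx.
  by rewrite mulr0 !addr0.
have -> : x <= - rho by case: xI => //; rewrite (negbTE rx).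
by rewrite mulr0 add0r opprK mulNr addrC.
Qed.

(** [xget] yields the default [(0, 0)] unless some pair fits, so a fitting pair has to be produced.
    The factor in [h_1] makes [eR kap] a particular solution of the exterior equation; subtracting
    it from the resolvent solution leaves a homogeneous one, whose two constants are the
    coefficients. *)
Lemma right_coefsP : exists g, resolvent H (k ^+ 2) (h1 rho k) g /\
  proj rho g = proj rho (right_wave (right_coefs H rho k)) %[ae mu].
Proof.
rewrite -f1_formE.
suff : exists c, [set c | exists g, resolvent H (k ^+ 2) (h1 rho k) g /\
    proj rho g = f1_form rho k c %[ae mu]] c by move=> /(xgetPex (0, 0)).
have [h_2 _] := L2ext_h1.
have [g Hg] := resolvent_exists res_k h_2.
have [u [u1 [Wu gu]]] := resolvent_W22 rho_gt0 q_ext H_q h_2 Hg.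
have [x _|a [b wE]] := W22_homogeneous_ext (W22_lin (- 1) W_eR_kap Wu).
  have kap2 : kap * kap = - k^* ^+ 2 by rewrite mulrNN -expr2 sqr_i_mul.
  by rewrite h1E [kap * (kap * _)]mulrA kap2; ring.
exists (a, b), g; split => //; rewrite f1_formE.
apply/aeP; move/aeP : gu; apply: ae_filterS => x ->.
rewrite /proj; case: ifPn => // /wE /eqP; rewrite mulN1r addrC subr_eq => /eqP ->.
by rewrite /right_wave addrA.
Qed.

Lemma left_coefsP : exists g, resolvent H (k ^+ 2) (h2 rho k) g /\
  proj rho g = proj rho (left_wave (left_coefs H rho k)) %[ae mu].
Proof.
rewrite -f2_formE.
suff : exists c, [set c | exists g, resolvent H (k ^+ 2) (h2 rho k) g /\
    proj rho g = f2_form rho k c %[ae mu]] c by move=> /(xgetPex (0, 0)).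
have [h_2 _] := L2ext_h2.
have [g Hg] := resolvent_exists res_k h_2.
have [u [u1 [Wu gu]]] := resolvent_W22 rho_gt0 q_ext H_q h_2 Hg.
have [x _|a [b wE]] := W22_homogeneous_ext (W22_lin (- 1) W_eL_kap Wu).
  have kap2 : - kap * - kap = - k^* ^+ 2 by rewrite mulrNN mulrNN -expr2 sqr_i_mul.
  by rewrite h2E [- kap * (- kap * _)]mulrA kap2; ring.
(* The reflected wave now lives on the left half-line, so the two constants change places in the
   pair. *)
exists (b, a), g; split => //; rewrite f2_formE.
apply/aeP; move/aeP : gu; apply: ae_filterS => x ->.
rewrite /proj; case: ifPn => // /wE /eqP; rewrite mulN1r addrC subr_eq => /eqP ->.
by rewrite /left_wave addrA.
Qed.

(** * Cauchy data of the elements of D(H_k) *)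

Lemma minimal_domain u u1 u2 : W22 rho u u1 u2 ->
  u rho = 0 -> u (- rho) = 0 -> u1 rho = 0 -> u1 (- rho) = 0 ->
  H (proj rho u) (fun x => - proj rho u2 x).
Proof.
move=> Wu ? ? ? ?; have [_ _ + _] := H_rho; apply.
have [u_2 _ u22 _ _] := Wu; split => //.
  by have := L2_scale (- 1) u22; congr L2; apply/funext => x; rewrite mulN1r.
exists u, u1, u2; split => //; apply/aeP; apply: aeW => x //.
by rewrite /proj; case: ifP => // _; rewrite oppr0.
Qed.

(** Cramer's rule for a system of determinant [(z' - z) e e']. *)
Lemma cauchy_data (z z' e e' A B : C) : z - z' != 0 -> e != 0 -> e' != 0 ->
  exists c d, c * e + d * e' = A /\ c * (z * e) + d * (z' * e') = B.
Proof.
move=> zz e0 e'0; exists ((B - z' * A) / (z - z') / e), ((z * A - B) / (z - z') / e').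
by split; field; rewrite e0 e'0 zz.
Qed.

Let eR_rho z : eR z rho = cexp (z * rho%:C).
Proof. by rewrite /cexp_on in_itv/= lexx. Qed.

Let eL_rho z : eL z (- rho) = cexp (z * (- rho)%:C).
Proof. by rewrite /cexp_on in_itv/= lexx. Qed.

Let eR_Nrho z : eR z (- rho) = 0.
Proof.
rewrite /cexp_on ifF//; apply/negP => xR.
by apply: (@disjoint_half_lines _ rho rho_gt0 (- rho)); rewrite ?in_itv/=.
Qed.

Let eL_Nrho z : eL z rho = 0.
Proof.
rewrite /cexp_on ifF//; apply/negP => xR.
by apply: (@disjoint_half_lines _ rho rho_gt0 rho); rewrite ?in_itv/= ?lexx.
Qed.

Let ext_rho : ext rho rho. Proof. by rewrite /ext /= ler_norm. Qed.

Let ext_Nrho : ext rho (- rho). Proof. by rewrite /ext /= normrN ler_norm. Qed.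

Lemma domHk_boundary f : domHk H rho k f -> exists u u1 u2 a b,
  [/\ W22 rho u u1 u2, f = proj rho u %[ae mu] &
    forall x, x = rho \/ x = - rho ->
      u x = a * right_wave (right_coefs H rho k) x + b * left_wave (left_coefs H rho k) x /\
      u1 x = a * right_wave_deriv (right_coefs H rho k) x + b * left_wave_deriv (left_coefs H rho k) x].
Proof.
move=> [f2 [h [g [[h_2 hE] Hg fg]]]].
have [u [u1 [Wu gu]]] := resolvent_W22 rho_gt0 q_ext H_q h_2 Hg.
have [g1 [Hg1 g1E]] := right_coefsP; have [g2 [Hg2 g2E]] := left_coefsP.
set c1 := right_coefs H rho k in g1E *; set c2 := left_coefs H rho k in g2E *.
have kapN_lamN : - kap - - lam != 0 by rewrite -(opprD kap) oppr_eq0.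
(* Only the coefficients [a] and [b] of the [kap] exponentials reach the conclusion; [a'] and [b']
   are absorbed by the reflected and transmitted parts of the waves. *)
have [a [a' [aE aE']]] := cauchy_data (u rho) (u1 rho) kap_lam
  (cexp_neq0 (kap * rho%:C)) (cexp_neq0 (lam * rho%:C)).
have [b [b' [bE bE']]] := cauchy_data (u (- rho)) (u1 (- rho)) kapN_lamN
  (cexp_neq0 (- kap * (- rho)%:C)) (cexp_neq0 (- lam * (- rho)%:C)).
pose u0 x := - a * eR kap x + (- a' * eR lam x +
  (- b * eL (- kap) x + (- b' * eL (- lam) x + u x))).
pose u01 x := - a * (kap * eR kap x) + (- a' * (lam * eR lam x) +
  (- b * (- kap * eL (- kap) x) + (- b' * (- lam * eL (- lam) x) + u1 x))).
pose u02 x := - a * (kap * (kap * eR kap x)) + (- a' * (lam * (lam * eR lam x)) +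
  (- b * (- kap * (- kap * eL (- kap) x)) +
  (- b' * (- lam * (- lam * eL (- lam) x)) + - (h x + k ^+ 2 * u x)))).
have Wu0 : W22 rho u0 u01 u02.
  exact: (W22_lin (- a) W_eR_kap (W22_lin (- a') W_eR_lam
    (W22_lin (- b) W_eL_kap (W22_lin (- b') W_eL_lam Wu)))).
have u0R : u0 rho = 0 by rewrite /u0 !eR_rho !eL_Nrho -aE; ring.
have u0L : u0 (- rho) = 0 by rewrite /u0 !eR_Nrho !eL_rho -bE; ring.
have u01R : u01 rho = 0 by rewrite /u01 !eR_rho !eL_Nrho -aE'; ring.
have u01L : u01 (- rho) = 0 by rewrite /u01 !eR_Nrho !eL_rho -bE'; ring.
have Hu0 := minimal_domain Wu0 u0R u0L u01R u01L.
have Hsum := op_linear a Hg1 (op_linear b Hg2 Hu0).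
have gE : g = (fun x => a * g1 x + (b * g2 x + proj rho u0 x)) %[ae mu].
  have Hres : resolvent H (k ^+ 2) (proj rho h)
      (fun x => a * g1 x + (b * g2 x + proj rho u0 x)).
    rewrite /resolvent; move: Hsum; congr (op_graph H _ _); apply/funext => x.
    have kap2 : kap * kap = - k^* ^+ 2 by rewrite mulrNN -expr2 sqr_i_mul.
    have lam2 : lam * lam = - k ^+ 2 by rewrite -expr2 sqr_i_mul.
    (* In the gap all the data vanish. On the exterior the [lam] terms of [- u02] agree with those
       of [k^2 u0], and the [kap] terms are balanced by [a h_1 + b h_2], so that only [h] is
       left. *)
    rewrite /proj; case: ifPn => xe; last first.
      have xR : eR kap x = 0.
        by rewrite /cexp_on ifF//; apply/negP => xR; case/negP: xe; apply/ext_itv; left.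
      have xL : eL (- kap) x = 0.
        by rewrite /cexp_on ifF//; apply/negP => xL; case/negP: xe; apply/ext_itv; right.
      by rewrite h1E h2E xR xL; ring.
    have kapN2 : - kap * - kap = - k^* ^+ 2 by rewrite mulrNN.
    have lamN2 : - lam * - lam = - k ^+ 2 by rewrite mulrNN.
    rewrite h1E h2E /u02 (mulrA kap kap) (mulrA lam lam).
    rewrite (mulrA (- kap) (- kap)) (mulrA (- lam) (- lam)).
    by rewrite kap2 lam2 kapN2 lamN2 /u0; ring.
  exact: (resolvent_unique res_k Hg Hres hE).
have [d2r W1] := W22_right_wave c1; have [d2l W2] := W22_left_wave c2.
have W := W22_lin a W1 (W22_lin b W2 Wu0).
exists u, u1, (fun x => - (h x + k ^+ 2 * u x)), a, b; split => //.
  by apply/aeP; move/aeP : fg => fg; move/aeP : gu => gu; apply: ae_filterS2 fg gu => x -> ->.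
have uE : proj rho u = proj rho (fun x => a * right_wave c1 x + (b * left_wave c2 x + u0 x)) %[ae mu].
  rewrite (proj_lin rho a (right_wave c1)) (proj_lin rho b (left_wave c2) u0).
  apply/aeP; move/aeP : gu => gu; move/aeP : gE => gE.
  move/aeP : g1E => g1E; move/aeP : g2E => g2E.
  have := ae_filterS2 (fun x p q => conj p q) (ae_filterS2 (fun x p q => conj p q) gu gE)
    (ae_filterS2 (fun x p q => conj p q) g1E g2E).
  apply: ae_filterS => x /= [[<- gx] [<- <-]]; rewrite {1}/proj gx /proj.
  by case: ifPn => xe; rewrite ?xe ?mulr0 ?addr0.
(* Both sides are [W22] functions, so the equality of classes becomes an equality of Cauchy data at
   [+- rho], where [u0] contributes nothing. *)
have uniq := W22_unique Wu W uE.
move=> x [->|->].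
  by have [-> ->] := uniq _ ext_rho; rewrite u0R u01R !addr0.
by have [-> ->] := uniq _ ext_Nrho; rewrite u0L u01L !addr0.
Qed.

(** Removing the waves from [u] leaves an element of the minimal domain, on which [H] is known.
    Hence [f] is the projection of [a g1 + b g2 + u0], and [H - k^2] maps this sum to a function
    supported in the exterior. *)
Lemma boundary_domHk u u1 u2 a b f : W22 rho u u1 u2 ->
  (forall x, x = rho \/ x = - rho ->
    u x = a * right_wave (right_coefs H rho k) x + b * left_wave (left_coefs H rho k) x /\
    u1 x = a * right_wave_deriv (right_coefs H rho k) x + b * left_wave_deriv (left_coefs H rho k) x) ->
  L2 f -> f = proj rho u %[ae mu] -> domHk H rho k f.
Proof.
move=> Wu uE f2 fu.
have [g1 [Hg1 g1E]] := right_coefsP; have [g2 [Hg2 g2E]] := left_coefsP.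
set c1 := right_coefs H rho k in g1E uE; set c2 := left_coefs H rho k in g2E uE.
have [d2r W1] := W22_right_wave c1; have [d2l W2] := W22_left_wave c2.
pose u0 x := - a * right_wave c1 x + (- b * left_wave c2 x + u x).
pose u01 x := - a * right_wave_deriv c1 x + (- b * left_wave_deriv c2 x + u1 x).
pose u02 x := - a * d2r x + (- b * d2l x + u2 x).
have Wu0 : W22 rho u0 u01 u02 := W22_lin (- a) W1 (W22_lin (- b) W2 Wu).
have [uR u1R] := uE rho (or_introl erefl).
have [uL u1L] := uE (- rho) (or_intror erefl).
have u0R : u0 rho = 0 by rewrite /u0 uR; ring.
have u0L : u0 (- rho) = 0 by rewrite /u0 uL; ring.
have u01R : u01 rho = 0 by rewrite /u01 u1R; ring.
have u01L : u01 (- rho) = 0 by rewrite /u01 u1L; ring.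
have Hu0 := minimal_domain Wu0 u0R u0L u01R u01L.
have Hsum := op_linear a Hg1 (op_linear b Hg2 Hu0).
split => //.
(* The image of the sum under [H - k^2], with [u02] standing for the second derivative of [u0]. *)
pose h x := a * h1 rho k x + (b * h2 rho k x +
  (- k ^+ 2 * proj rho u0 x + - 1 * proj rho u02 x)).
exists h, (fun x => a * g1 x + (b * g2 x + proj rho u0 x)); split.
- have [u0_2 _ u02_2 _ _] := Wu0.
  have [h1_2 /aeP h1_ext] := L2ext_h1; have [h2_2 /aeP h2_ext] := L2ext_h2.
  split.
    apply: (L2_lin a h1_2 (L2_lin b h2_2 (L2_lin (- k ^+ 2) u0_2 _))).
    exact: L2_scale.
  apply/aeP; apply: ae_filterS2 h1_ext h2_ext => x h1x h2x.
  rewrite /h; move: h1x h2x; rewrite /proj; case: ifP => // _ -> ->.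
  by ring.
- rewrite /resolvent; move: Hsum; congr (op_graph H _ _); apply/funext => x.
  by rewrite /h; ring.
- apply/aeP; move/aeP : fu => fu; move/aeP : g1E => g1E; move/aeP : g2E => g2E.
  have := ae_filterS2 (fun x p q => conj p q) fu (ae_filterS2 (fun x p q => conj p q) g1E g2E).
  apply: ae_filterS => x [-> [+ +]]; rewrite /proj; case: ifPn => // xe -> ->.
  by rewrite /u0; ring.
Qed.

Lemma right_wave_domHk : domHk H rho k (proj rho (right_wave (right_coefs H rho k))).
Proof.
have [d2r W1] := W22_right_wave (right_coefs H rho k).
apply: (@boundary_domHk _ _ _ 1 0 _ W1) => [x _|//|].
- by rewrite !mul1r !mul0r !addr0.
- by have [] := W1.
- by apply/aeP; exact: aeW.
Qed.

Lemma left_wave_domHk : domHk H rho k (proj rho (left_wave (left_coefs H rho k))).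
Proof.
have [d2l W2] := W22_left_wave (left_coefs H rho k).
apply: (@boundary_domHk _ _ _ 0 1 _ W2) => [x _|//|].
- by rewrite !mul1r !mul0r !add0r.
- by have [] := W2.
- by apply/aeP; exact: aeW.
Qed.

(** [boundary_matrix] only provides some representative satisfying the relation; uniqueness
    transfers it to the given one. *)
Lemma boundary_matrix_values T u u1 u2 : boundary_matrix H rho k T ->
  W22 rho u u1 u2 -> domHk H rho k (proj rho u) ->
  T *m col2 (u rho + u1 rho) (u (- rho) - u1 (- rho)) =
    2^-1 *: col2 (u rho) (u (- rho)).
Proof.
move=> TP Wu /TP[_ [v [v1 [v2 [Wv uv TE]]]]].
have uniq := W22_unique Wu Wv uv.
by have [-> ->] := uniq _ ext_rho; have [-> ->] := uniq _ ext_Nrho.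
Qed.

Local Notation E := (cexp (kap * rho%:C)).
Local Notation F := (cexp (lam * rho%:C)).
Local Notation rr := (right_coefs H rho k).1.
Local Notation tr := (right_coefs H rho k).2.
Local Notation rl := (left_coefs H rho k).1.
Local Notation tl := (left_coefs H rho k).2.

(* The columns of [Gamma0] and [Gamma1] are the boundary values of [f_1] and
   [f_2], in the coordinates of [boundary_matrix]. *)
Definition Gamma0 : 'M[C]_2 := mat2 (2^-1 * (rr * F + E)) (2^-1 * (tl * F))
  (2^-1 * (tr * F)) (2^-1 * (rl * F + E)).

Definition Gamma1 : 'M[C]_2 :=
  mat2 ((1 + lam) * (rr * F) + (1 + kap) * E) ((1 + lam) * (tl * F))
    ((1 + lam) * (tr * F)) ((1 + lam) * (rl * F) + (1 + kap) * E).

Let boundaryE (c1 c2 : C * C) :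
  [/\ right_wave c1 rho = c1.1 * F + E, right_wave c1 (- rho) = c1.2 * F,
      right_wave_deriv c1 rho = c1.1 * (lam * F) + kap * E &
      right_wave_deriv c1 (- rho) = - (c1.2 * (lam * F))] /\
  [/\ left_wave c2 rho = c2.2 * F, left_wave c2 (- rho) = c2.1 * F + E,
      left_wave_deriv c2 rho = c2.2 * (lam * F) &
      left_wave_deriv c2 (- rho) = - (c2.1 * (lam * F) + kap * E)].
Proof.
(* Changing the sign of both exponent and point changes nothing, so the same two numbers [E] and [F]
   serve at both ends. *)
have lamN : - lam * (- rho)%:C = lam * rho%:C by rewrite rmorphN mulrNN.
have kapN : - kap * (- rho)%:C = kap * rho%:C by rewrite rmorphN mulrNN.
rewrite /right_wave /right_wave_deriv /left_wave /left_wave_deriv !eR_rho !eL_Nrho !eR_Nrho !eL_rho lamN kapN.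
by split; split; ring.
Qed.

(** * Algebra of two by two matrices *)

Lemma mulmx_mat2_col2 (a b c d x y : C) :
  mat2 a b c d *m col2 x y = col2 (a * x + b * y) (c * x + d * y).
Proof.
apply/matrixP => i j; rewrite !mxE !big_ord_recl big_ord0 !mxE /= addr0.
by case: ifP.
Qed.

Lemma mulmx_mat2P (T : 'M[C]_2) (a b c d a' b' c' d' : C) :
  T *m mat2 a b c d = mat2 a' b' c' d' <->
  T *m col2 a c = col2 a' c' /\ T *m col2 b d = col2 b' d'.
Proof.
split=> [TE|[/matrixP T1 /matrixP T2]].
  by split; apply/matrixP => i j; [have := congr1 (fun M : 'M[C]_2 => M i 0) TE|
    have := congr1 (fun M : 'M[C]_2 => M i 1) TE];
    rewrite !mxE !big_ord_recl !big_ord0 !mxE.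
apply/matrixP => i j; have := T1 i 0; have := T2 i 0.
rewrite !mxE !big_ord_recl !big_ord0 !mxE /= => E2 E1.
by case: (j == 0); [rewrite E1|rewrite E2].
Qed.

Lemma scale_col2 (a x y : C) : a *: col2 x y = col2 (a * x) (a * y).
Proof. by apply/matrixP => i j; rewrite !mxE; case: ifP. Qed.

Lemma col2_inj (x y x' y' : C) : col2 x y = col2 x' y' -> x = x' /\ y = y'.
Proof.
move=> E; have := congr1 (fun M : 'cV[C]_2 => M 0 0) E.
by have := congr1 (fun M : 'cV[C]_2 => M 1 0) E; rewrite !mxE /= => -> ->.
Qed.

Lemma scale_mat2 (t a b c d : C) :
  t *: mat2 a b c d = mat2 (t * a) (t * b) (t * c) (t * d).
Proof. by apply/matrixP => i j; rewrite !mxE; case: ifP; case: ifP. Qed.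

Lemma sub_mat2 (a b c d a' b' c' d' : C) : mat2 a b c d - mat2 a' b' c' d' =
  mat2 (a - a') (b - b') (c - c') (d - d').
Proof. by apply/matrixP => i j; rewrite !mxE; case: ifP; case: ifP. Qed.

Lemma scalar_mat2 (a : C) : a%:M = mat2 a 0 0 a.
Proof.
apply/matrixP => i j; rewrite !mxE.
by case: i => -[|[|//]] ?; case: j => -[|[|//]] ?.
Qed.

Lemma det_mat2 (a b c d : C) : \det (mat2 a b c d) = a * d - b * c.
Proof.
rewrite (expand_det_row _ 0) !big_ord_recl big_ord0 /cofactor !det_mx11 !mxE /=.
by rewrite !expr0 expr1 mul1r mulN1r addr0 mulrN.
Qed.

Lemma boundary_matrix_Gamma T : boundary_matrix H rho k T ->
  T *m Gamma1 = Gamma0.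
Proof.
move=> TP; apply/mulmx_mat2P.
have [[r1 r2 r3 r4] [l1 l2 l3 l4]] :=
  boundaryE (right_coefs H rho k) (left_coefs H rho k).
have [d2r W1] := W22_right_wave (right_coefs H rho k).
have [d2l W2] := W22_left_wave (left_coefs H rho k).
have := boundary_matrix_values TP W1 right_wave_domHk.
have := boundary_matrix_values TP W2 left_wave_domHk.
rewrite r1 r2 r3 r4 l1 l2 l3 l4 !scale_col2 => E2 E1; split.
  by rewrite -E1; congr (_ *m col2 _ _); ring.
by rewrite -E2; congr (_ *m col2 _ _); ring.
Qed.

(** Having the Cauchy data of [a f_1 + b f_2] means having boundary vectors [Gamma0 v] and
    [Gamma1 v] with [v = (a, b)]. If [T g] is the first vector and [g] the second, then
    [v = Gamma1^-1 g] works, since [Gamma0 v = T Gamma1 v = T g]. *)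
Lemma boundary_matrixP T : Gamma1 \in unitmx -> T *m Gamma1 = Gamma0 ->
  boundary_matrix H rho k T.
Proof.
move=> G1 TE.
have [[r1 r2 r3 r4] [l1 l2 l3 l4]] :=
  boundaryE (right_coefs H rho k) (left_coefs H rho k).
have comb u u1 (a b : C) : (forall x, x = rho \/ x = - rho ->
      u x = a * right_wave (right_coefs H rho k) x + b * left_wave (left_coefs H rho k) x /\
      u1 x = a * right_wave_deriv (right_coefs H rho k) x + b * left_wave_deriv (left_coefs H rho k) x) <->
    2^-1 *: col2 (u rho) (u (- rho)) = Gamma0 *m col2 a b /\
    col2 (u rho + u1 rho) (u (- rho) - u1 (- rho)) = Gamma1 *m col2 a b.
  rewrite !mulmx_mat2_col2 scale_col2; split => [uE|[]].
    have [-> ->] := uE _ (or_introl erefl); have [-> ->] := uE _ (or_intror erefl).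
    by rewrite r1 r2 r3 r4 l1 l2 l3 l4; split; congr col2; ring.
  move=> /col2_inj[e1 e2] /col2_inj[e3 e4].
  have two : (2 : C) != 0 by rewrite pnatr_eq0.
  have uR : u rho = a * (rr * F + E) + b * (tl * F).
    by rewrite -[LHS](mulVKf two) e1; field.
  have uL : u (- rho) = a * (tr * F) + b * (rl * F + E).
    by rewrite -[LHS](mulVKf two) e2; field.
  have u1R : u1 rho = - u rho + (u rho + u1 rho) by ring.
  have u1L : u1 (- rho) = u (- rho) - (u (- rho) - u1 (- rho)) by ring.
  move=> x [->|->].
    by rewrite u1R e3 uR r1 r3 l1 l3; split; ring.
  by rewrite u1L e4 uL r2 r4 l2 l4; split; ring.
move=> f; split=> [fH|[f2 [u [u1 [u2 [Wu fu TuE]]]]]].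
  split; first by case: fH.
  have [u [u1 [u2 [a [b [Wu fu /comb[e0 e1]]]]]]] := domHk_boundary fH.
  by exists u, u1, u2; split => //; rewrite e0 e1 mulmxA TE.
set g := col2 (u rho + u1 rho) (u (- rho) - u1 (- rho)) in TuE.
pose v := invmx Gamma1 *m g.
have vE : v = col2 (v 0 0) (v 1 0).
  apply/matrixP => i j; rewrite [RHS]mxE (ord1 j).
  by case: ifP => [/eqP->//|i0]; congr (v _ _); apply/val_inj;
    case: i i0 => -[|[|[]]].
apply: (@boundary_domHk u u1 u2 (v 0 0) (v 1 0)) => //; apply/comb.
by rewrite -vE -TuE -TE -mulmxA mulKVmx.
Qed.

(** * Determinant of the boundary values and evaluation of S(k) *)

Let conj_theta : (1 + lam)^* = 1 + kap.
Proof. by case: k => a b; apply: complex_eq; rewrite /=; ring. Qed.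

Let Re_kE : (Re k)%:C = (k + k^*) / 2.
Proof. exact: ReJ_add. Qed.

Let Im_kE : 'i * (Im k)%:C = (k - k^*) / 2.
Proof.
case: k => a b; apply: (@mulIf _ 2); rewrite ?pnatr_eq0//.
rewrite mulfVK ?pnatr_eq0//; apply: complex_eq; rewrite /=; ring.
Qed.

Let lamB_kap : lam - kap = 2 * 'i * (Re k)%:C.
Proof. by rewrite Re_kE; field. Qed.

(** Origin of the phase [exp (2 i rho Re k)]: it is the ratio at [rho] of the outgoing to the
    incoming exponential. *)
Let FE : F = E * cexp (2 * 'i * rho%:C * (Re k)%:C).
Proof.
rewrite -cexpD; congr cexp; rewrite (_ : 2 * 'i * rho%:C * (Re k)%:C =
  (2 * 'i * (Re k)%:C) * rho%:C); last by ring.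
by rewrite -lamB_kap; ring.
Qed.

(** The imaginary part of [1 + i k] is [Re k]; the excluded zero would be [k = i]. *)
Let theta_neq0 : 1 + lam != 0.
Proof.
apply/eqP => /(congr1 Im); case: k Re_k => a b /= a0 /eqP.
by rewrite mul0r mul1r add0r add0r (negbTE a0).
Qed.

Hypothesis Delta_neq0 : Delta H rho k != 0.

Lemma Gamma1_unit : Gamma1 \in unitmx.
Proof.
rewrite unitmxE unitfE.
(* Taking [(1 + lam) F] out of each entry leaves the transpose of the matrix of [Delta]: on the
   diagonal, the ratio of [(1 + kap) E] to this factor is the shift in [Delta]. *)
suff -> : \det Gamma1 = ((1 + lam) * F) ^+ 2 * Delta H rho k.
  by rewrite mulf_neq0// expf_neq0// mulf_neq0// cexp_neq0.
rewrite /Delta /Rr /Tr /Rl /Tl conj_theta !det_mat2.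
have X0 := cexp_neq0 (2 * 'i * rho%:C * (Re k)%:C).
have -> : cexp (- (2 * 'i * rho%:C * (Re k)%:C)) =
    (cexp (2 * 'i * rho%:C * (Re k)%:C))^-1.
  by apply: (mulIf X0); rewrite -cexpD addNr cexp0 mulVf.
rewrite FE; move: (cexp _) (cexp _) X0 theta_neq0 => e X X0 t0.
by field; rewrite X0 t0.
Qed.

(** Stated for every [T] with [T Gamma1 = Gamma0], because S(k) is built from a matrix that [xget]
    selects rather than from an explicit one. *)
Lemma Smatrix_formula (T : 'M[C]_2) : T *m Gamma1 = Gamma0 ->
  let d := 'i * cexp (- (2 * 'i * rho%:C * (Re k)%:C)) * ((Im k)%:C / k) in
  1%:M - (2 * (1 + lam)) *: T \in unitmx /\
  (1%:M - (2 * (1 - lam)) *: T) *m invmx (1%:M - (2 * (1 + lam)) *: T) =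
    (- (cexp (2 * 'i * rho%:C * (Re k)%:C) * (k / (Re k)%:C))) *:
      mat2 (rr + d) tl tr (rl + d).
Proof.
move=> TE d.
have G (c : C) : (1%:M - c *: T) *m Gamma1 = Gamma1 - c *: Gamma0.
  by rewrite mulmxBl mul1mx -scalemxAl TE.
set s := (kap - lam) * E.
have s0 : s != 0 by rewrite mulf_neq0// cexp_neq0.
have two : (2 : C) != 0 by rewrite pnatr_eq0.
have E0 := cexp_neq0 (kap * rho%:C).
have X0 := cexp_neq0 (2 * 'i * rho%:C * (Re k)%:C).
have Xinv : cexp (- (2 * 'i * rho%:C * (Re k)%:C)) =
    (cexp (2 * 'i * rho%:C * (Re k)%:C))^-1.
  by apply: (mulIf X0); rewrite -cexpD addNr cexp0 mulVf.
have inv : (1%:M - (2 * (1 + lam)) *: T) *m (s^-1 *: Gamma1) = 1%:M.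
  rewrite -scalemxAr G scale_mat2 sub_mat2 scale_mat2 scalar_mat2.
  by congr mat2; rewrite /s; field; rewrite ?two ?E0 ?kap_lam.
have [Aunit _] := mulmx1_unit inv; split => //.
have -> : invmx (1%:M - (2 * (1 + lam)) *: T) = s^-1 *: Gamma1.
  by rewrite -[RHS](mulKmx Aunit) inv mulmx1.
(* The entries of [Gamma1 - 2 (1 - lam) Gamma0] are [2 lam F] times the coefficients, plus
   [(lam + kap) E] on the diagonal. Since [lam + kap = - 2 Im k], dividing by [s] and taking out the
   prefactor [- (F / E) k / Re k] leaves the coefficients and [d]. *)
rewrite -scalemxAr G scale_mat2 sub_mat2 !scale_mat2.
have k0 : k != 0 by apply: contraNneq Re_k => ->.
have i0 : ('i%C : C) != 0.
  apply/negP => /eqP i0; have := @sqr_i R.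
  by rewrite i0 expr0n /= => /esym/eqP; rewrite oppr_eq0 oner_eq0.
have kk : k + k^* != 0.
  apply: contraNneq Re_k => kk; apply/eqP/(@complexI R).
  by rewrite Re_kE kk mul0r.
(* Everything is now expressed through [k], its conjugate and two nonzero exponentials, so that only
   rational identities remain. *)
have dE : d = (cexp (2 * 'i * rho%:C * (Re k)%:C))^-1 * ((k - k^*) / 2 / k).
  by rewrite /d Xinv -Im_kE; ring.
rewrite dE FE Re_kE /s -Re_kE.
move: E0 X0; move: (cexp (kap * _)) (cexp (2 * _ * _ * _)) => e X E0 X0.
have kl := kap_lam.
by rewrite Re_kE; congr mat2; field; rewrite ?X0 ?E0 ?kk ?k0 ?i0 ?kl ?two.
Qed.

End scattering.

Theorem theorem3p5 (R : realType) (rho : R) (q : R -> R[i]) (H : L2operator R)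
    (rho_gt0 : 0 < rho)
    (q_supp : closure [set x | q x != 0] `<=` `]- rho, rho[%classic)
    (q_PT : forall x, q x = conjc (q (- x)))
    (H_q : acts_as_schrodinger q H)
    (H_closed : closed_operator H)
    (H_dense : densely_defined H)
    (H_PT : PT_symmetric H)
    (H_rho : rho_perturbed rho H)
    (k : R[i]) (k_Lambda : LambdaP H k) (Delta_neq0 : Delta H rho k != 0) :
  let d := 'i%C * cexp (- (2 * 'i%C * rho%:C * (complex.Re k)%:C)) * ((complex.Im k)%:C / k) in
  Smatrix_exists H rho k /\
  Smatrix H rho k =
    (- (cexp (2 * 'i%C * rho%:C * (complex.Re k)%:C) * (k / (complex.Re k)%:C))) *:
      mat2 (Rr H rho k + d) (Tl H rho k) (Tr H rho k) (Rl H rho k + d).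
Proof.
move=> d.
have q_ext x : ext rho x -> q x = 0.
  rewrite /ext /= leNgt => /negP xr; apply: contrapT => /eqP qx; apply: xr.
  have /q_supp : closure [set x | q x != 0] x by exact: subset_closure.
  by rewrite /= in_itv/= ltr_norml.
have G1u := Gamma1_unit k_Lambda Delta_neq0.
have formula := Smatrix_formula k_Lambda.
have admissible : admissible_matrix H rho k (Gamma0 rho H k *m invmx (Gamma1 rho H k)).
  have TG := mulmxKV G1u (Gamma0 rho H k).
  by split; [exact: boundary_matrixP q_ext H_q H_rho k_Lambda _ G1u TG|
    by have [] := formula _ _ TG].
split; first by exists (Gamma0 rho H k *m invmx (Gamma1 rho H k)).
(* As an admissible matrix exists, the one selected by [xget] is admissible; it therefore also sends
   [Gamma1] to [Gamma0], and the formula applies to it. *)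
have [TP _] := xgetPex 0 (ex_intro _ _ admissible).
have [_ SE] := formula _ _ (boundary_matrix_Gamma rho_gt0 q_ext H_q H_rho k_Lambda TP).
exact: SE.
Qed.
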